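(* Let $G:\mathcal{P}_2(\mathbb{R}^d)\to\mathbb{R}$ be Hölder continuous with respect to the 2-Wasserstein distance, i.e. there exist $L_G>0$ and $\alpha\in(0,1]$ such that $|G(\mu)-G(\nu)|\le L_G\,|\mathcal{W}_2(\mu,\nu)|^\alpha$ for all $\mu,\nu\in\mathcal{P}_2(\mathbb{R}^d)$. Assume that $G$ admits a global minimizer $\mu^*$ with finite second moment ($\int|x|^2d\mu^*(x)<\infty$). Let $\mathcal{V}_0=\inf_{\mu\in\mathcal{P}_2(\mathbb{R}^d)}G(\mu)$ and let $x_0\in\mathbb{R}^d$. Then $$0\le\mathcal{V}_\varepsilon(0,\delta_{x_0})-\mathcal{V}_0\le C\,\varepsilon\ln\left(\frac1\varepsilon\right),\quad\text{for }\varepsilon\in(0,e^{-1}),$$ for some constant $C>0$ depending on $d$, $L_G$, $\alpha$ and $\mathcal{W}_2(\delta_{x_0},\mu^* )$.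
   Context: $\mathcal{P}_2(\mathbb{R}^d)$ is the space of probability measures on $\mathbb{R}^d$ with finite second moment, with the 2-Wasserstein metric $\mathcal{W}_2$; $\mathcal{L}(\zeta)$ denotes the law of $\zeta$. $\mathcal{V}_\varepsilon$ is the value function of the regularized mean-field control problem; at $(0,\delta_{x_0})$ it is $$\mathcal{V}_\varepsilon(0,\delta_{x_0})=\inf_{\theta\in\Theta}\left\{G\big(\mathcal{L}(X_1^{0,x_0;\theta})\big)+\mathbb{E}\left[\frac\varepsilon2\int_0^1|\theta_s|^2ds\right]\right\},\qquad X_t^{0,x_0;\theta}=x_0+\int_0^t\theta_s\,ds+W_t,$$ where $W$ is a standard $d$-dimensional Wiener process on a complete probability space, and $\Theta$ is the set of $\mathbb{R}^d$-valued processes $\theta$ on $[0,1]$ adapted to the augmented filtration generated by $W$ (the initial value $x_0$ is deterministic) with $\mathbb{E}\big[\big(\int_0^1|\theta_s|ds\big)^2\big]<\infty$. *)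

(* Defs.v *)
From HB Require Import structures.
From mathcomp Require Import all_boot all_order all_algebra.
From mathcomp Require Import all_classical all_reals all_analysis.
From mathcomp Require Import measurable_realfun.
From mathcomp Require Import ring lra.

Set Implicit Arguments.
Unset Strict Implicit.
Unset Printing Implicit Defensive.

Import Order.TTheory GRing.Theory Num.Theory.
Import numFieldNormedType.Exports.

Local Open Scope classical_set_scope.
Local Open Scope ring_scope.

(* R^d is d.-tuple R: the library equips it with the product sigma-algebra,
   i.e. the Borel sets of R^d. *)
Section euclidean.
Context {R : realType} {d : nat}.
Implicit Types x y : d.-tuple R.

Definition subv x y : d.-tuple R := [tuple tnth x i - tnth y i | i < d].

Definition normv x : R := Num.sqrt (\sum_(i < d) tnth x i ^+ 2).

Lemma sqr_normv x : normv x ^+ 2 = \sum_(i < d) tnth x i ^+ 2.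
Proof. by rewrite sqr_sqrtr// sumr_ge0// => i _; exact: sqr_ge0. Qed.

Lemma normv_ge0 x : 0 <= normv x.
Proof. exact: sqrtr_ge0. Qed.

Lemma ler_norm_normv x i : `|tnth x i| <= normv x.
Proof.
rewrite -(@ler_pXn2r _ 2)// ?nnegrE ?normv_ge0// sqr_normv real_normK ?num_real//.
by rewrite (bigD1 i)//= lerDl sumr_ge0// => j _; exact: sqr_ge0.
Qed.

Lemma measurable_sqr_normv :
  measurable_fun [set: d.-tuple R] (fun x => normv x ^+ 2).
Proof.
under [F in measurable_fun _ F]funext do rewrite sqr_normv.
apply: measurable_sum => i; apply: measurable_funX.
exact: measurable_tnth.
Qed.

Lemma measurable_normv : measurable_fun [set: d.-tuple R] normv.
Proof.
rewrite (_ : normv = fun x => Num.sqrt (normv x ^+ 2)); last first.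
  by apply/funext => x; rewrite sqrtr_sqr ger0_norm// normv_ge0.
apply: (measurableT_comp (f := @Num.sqrt R)).
  by apply: continuous_measurable_fun; exact: sqrt_continuous.
exact: measurable_sqr_normv.
Qed.

End euclidean.

Section wasserstein.
Context {R : realType} {d : nat}.
Local Open Scope ereal_scope.

Definition second_moment (mu : probability (d.-tuple R) R) : \bar R :=
  \int[mu]_x ((normv x) ^+ 2)%:E.

Definition couplings (mu nu : probability (d.-tuple R) R) :
    set (probability (d.-tuple R * d.-tuple R)%type R) :=
  [set pi | (forall A, measurable A -> pushforward pi fst A = mu A) /\
            (forall A, measurable A -> pushforward pi snd A = nu A)].

Definition W2 (mu nu : probability (d.-tuple R) R) : \bar R :=
  sqrte (ereal_inf [set \int[pi]_z ((normv (subv z.1 z.2)) ^+ 2)%:E |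
                    pi in couplings mu nu]).

End wasserstein.

Record P2 (R : realType) (d : nat) := MkP2 {
  P2_probability :> probability (d.-tuple R) R ;
  P2_second_moment : (second_moment P2_probability < +oo)%E }.

Section holder.
Context {R : realType} {d : nat}.
Local Open Scope ereal_scope.

Definition W2_holder (L alpha : R) (G : P2 R d -> R) :=
  forall mu nu : P2 R d,
    (`|G mu - G nu|%R)%:E <= L%:E * (W2 mu nu) `^ alpha.

End holder.

Section filtration.
Context {dO : measure_display} {Omega : measurableType dO} {R : realType}.
Context {d : nat}.
Variables (P : probability Omega R) (W : R -> {RV P >-> d.-tuple R}).

Definition natural_filtration (t : R) : set (set Omega) :=
  <<s \bigcup_(u in `[0, t]) preimage_set_system setT (W u) measurable >>.

Definition augmented_filtration (t : R) : set (set Omega) :=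
  <<s natural_filtration t `|` [set N | P.-negligible N] >>.

End filtration.

(* A random variable W t is given for every t : R, but nothing is required of
   it for t < 0. *)
Record wiener dO (Omega : measurableType dO) (R : realType)
    (P : probability Omega R) (d : nat) := MkWiener {
  wiener_rv :> R -> {RV P >-> d.-tuple R} ;
  wiener_zero : {ae P, forall w, forall i, tnth (wiener_rv 0 w) i = 0} ;
  wiener_continuous : {ae P, forall w, forall i,
    {within `[0, +oo[, continuous (fun t => tnth (wiener_rv t w) i)}} ;
  (* W t - W s has law N(0, (t - s) I_d); the second parameter of normal_prob
     is the standard deviation *)
  wiener_normal : forall s t, 0 <= s -> s < t ->
    forall A : 'I_d -> set R, (forall i, measurable (A i)) ->
    P [set w | forall i, A i (tnth (subv (wiener_rv t w) (wiener_rv s w)) i)] =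
    (\prod_(i < d) normal_prob 0 (Num.sqrt (t - s)) (A i))%E ;
  wiener_independent : forall s t, 0 <= s -> s < t ->
    forall (E : set Omega) (B : set (d.-tuple R)),
    natural_filtration wiener_rv s E -> measurable B ->
    let F := [set w | B (subv (wiener_rv t w) (wiener_rv s w))] in
    P (E `&` F) = (P E * P F)%E }.

Lemma normal_prob_sqr_integral (R : realType) :
  (\int[@normal_prob R 0 1]_x (x ^+ 2)%:E < +oo)%E.
Proof.
pose mu := @lebesgue_measure R.
pose nu : {finite_measure set (measurableTypeR R) -> \bar R} := @normal_prob R 0 1.
have numu : nu `<< mu by exact: normal_prob_dominates.
have mf : measurable_fun [set: R] (fun x : R => (x ^+ 2)%:E).
  apply/measurable_EFinP. exact: exprn_measurable.
rewrite -(Radon_Nikodym_SigmaFinite.change_of_variables numu)//; last first.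
  by move=> x; rewrite lee_fin sqr_ge0.
have mpdf s : measurable_fun [set: R] (fun x : R => (normal_pdf 0 s x)%:E).
  by apply/measurable_EFinP; exact: measurable_normal_pdf.
pose C : R := 3 * normal_peak 1 / normal_peak 2.
have key (y : R) : 0 <= y -> y <= 3 * expR (3 / 8 * y).
  by move=> y0; have := expR_ge1Dx (3 / 8 * y); lra.
rewrite (@le_lt_trans _ _ (\int[mu]_x (C%:E * (normal_pdf 0 2 x)%:E)%E)%E)//;
  last first.
  rewrite integralZl//; last exact: integrable_normal_pdf.
  by rewrite integral_normal_pdf mule1 ltry.
have -> : (\int[mu]_x ((x ^+ 2)%:E * Radon_Nikodym_SigmaFinite.f nu mu x) =
  \int[mu]_x ((x ^+ 2)%:E * (normal_pdf 0 1 x)%:E))%E.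
  apply: ae_eq_integral => //.
  - apply: emeasurable_funM => //; apply: (measurable_int mu).
    exact: Radon_Nikodym_SigmaFinite.f_integrable.
  - apply: emeasurable_funM; [exact: mf|exact: mpdf].
  - apply: ae_eqe_mul2l => /=.
    apply: integral_ae_eq => //=.
    + exact: Radon_Nikodym_SigmaFinite.f_integrable.
    + exact: mpdf.
    + by move=> E _ mE; rewrite -Radon_Nikodym_SigmaFinite.f_integral.
apply: ge0_le_integral => //.
- by move=> x _; rewrite -EFinM lee_fin mulr_ge0// ?sqr_ge0// normal_pdf_ge0.
- by apply: emeasurable_funM => //; exact: mpdf.
- by apply: emeasurable_funM => //; exact: mpdf.
move=> x _; rewrite -!EFinM lee_fin !normal_pdfE// /C.
rewrite [leRHS](_ : _ = normal_peak 1 * (3 * normal_fun 0 2 x)); last first.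
  by rewrite mulrA divfK ?gt_eqF ?normal_peak_gt0// mulrAC mulrC mulrA.
rewrite mulrCA ler_wpM2l ?normal_peak_ge0//.
rewrite /normal_fun subr0 expr1n.
rewrite (_ : - x ^+ 2 / (1 *+ 2) =
             - x ^+ 2 / (2 ^+ 2 *+ 2) - (3/8) * x ^+ 2); last by field.
rewrite expRD mulrCA mulrC ler_pM2r ?expR_gt0//.
rewrite expRN ler_pdivrMr ?expR_gt0//.
exact: (key (x ^+ 2) (sqr_ge0 _)).
Qed.

Lemma sqr_sum3_le (R : realType) (x y z : R) :
  (x + y + z) ^+ 2 <= 3 * x ^+ 2 + 3 * (y ^+ 2 + z ^+ 2).
Proof.
have := sqr_ge0 (x - y); have := sqr_ge0 (x - z); have := sqr_ge0 (y - z).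
nra.
Qed.

Section wiener_moment.
Context {dO : measure_display} {Omega : measurableType dO} {R : realType}.
Context {d : nat} {P : probability Omega R} (W : wiener P d).

Lemma measurable_wiener_coord t i :
  measurable_fun [set: Omega] (fun w => tnth (W t w) i).
Proof.
apply: (measurableT_comp (f := @tnth d R ^~ i)); first exact: measurable_tnth.
exact: measurable_funPT.
Qed.

Lemma wiener_coord_sqr_integral i :
  (\int[P]_w (tnth (W 1 w) i ^+ 2)%:E < +oo)%E.
Proof.
pose Y w := tnth (W 1 w) i - tnth (W 0 w) i.
have mY : measurable_fun [set: Omega] Y.
  by apply: measurable_funB; exact: measurable_wiener_coord.
have mf : measurable_fun [set: R] (fun x : R => (x ^+ 2)%:E).
  apply/measurable_EFinP; exact: exprn_measurable.
have -> : (\int[P]_w (tnth (W 1 w) i ^+ 2)%:E = \int[P]_w (Y w ^+ 2)%:E)%E.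
  apply: ge0_ae_eq_integral => //.
  - apply/measurable_EFinP/measurable_funX; exact: measurable_wiener_coord.
  - by apply/measurable_EFinP/measurable_funX.
  - by move=> w _; rewrite lee_fin sqr_ge0.
  - by move=> w _; rewrite lee_fin sqr_ge0.
  - have := wiener_zero W; apply: filterS => w Ww0 _.
    by rewrite /Y Ww0 subr0.
have := @ge0_integral_pushforward _ _ _ (measurableTypeR R) R _ mY P _ _
  measurableT mf.
rewrite preimage_setT => <-; last by move=> x _; rewrite lee_fin sqr_ge0.
rewrite (eq_measure_integral (normal_prob 0 1)); last first.
  move=> B mB _.
  pose A (j : 'I_d) : set R := if j == i then B else setT.
  have mA j : measurable (A j) by rewrite /A; case: ifP.
  have := wiener_normal W (lexx 0) ltr01 mA.
  rewrite subr0 sqrtr1 (bigD1 i)//= big1 ?mule1; last first.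
    by move=> j /negbTE ji; rewrite /A ji probability_setT.
  rewrite {2}/A eqxx => <-; congr (P _); apply/seteqP; split => w /=.
    rewrite /A => Bw j; case: ifP => // /eqP ->.
    by rewrite tnth_mktuple.
  by move=> /(_ i); rewrite /A eqxx tnth_mktuple.
exact: normal_prob_sqr_integral.
Qed.

End wiener_moment.

Section control.
Context {dO : measure_display} {Omega : measurableType dO} {R : realType}.
Context {d : nat} {P : probability Omega R}.
Local Open Scope ereal_scope.

(* Only the values of theta at times in [0, 1] matter. Joint measurability in
   (s, w) is what gives a meaning to the time integrals. *)
Record control (W : wiener P d) := MkControl {
  control_fun :> R -> Omega -> d.-tuple R ;
  control_measurable : measurable_fun
    (`[0%R, 1%R]%classic `*` setT : set (measurableTypeR R * Omega)%type)
    (fun sw : measurableTypeR R * Omega => control_fun sw.1 sw.2) ;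
  control_adapted : forall t : R, (0 <= t <= 1)%R ->
    forall A : set (d.-tuple R), measurable A ->
    augmented_filtration W t (control_fun t @^-1` A) ;
  control_integrable :
    \int[P]_w (\int[lebesgue_measure]_(s in `[0%R, 1%R])
                 (normv (control_fun s w))%:E) ^+ 2 < +oo }.

Variables (W : wiener P d) (x0 : d.-tuple R).

(* The time integral is Bochner's, i.e. coordinatewise; it exists for almost
   every w because of control_integrable. *)
Definition state (theta : control W) (t : R) (w : Omega) : d.-tuple R :=
  [tuple (tnth x0 i
          + (\int[lebesgue_measure]_(s in `[0%R, t]) tnth (theta s w) i)%R
          + tnth (W t w) i)%R | i < d].


Let leb : {sigma_finite_measure set (measurableTypeR R) -> \bar R} :=
  lebesgue_measure.

Definition drift_norm (theta : control W) (w : Omega) : \bar R :=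
  \int[lebesgue_measure]_(s in `[0%R, 1%R]) (normv (theta s w))%:E.

Lemma measurable_drift_norm (theta : control W) :
  measurable_fun [set: Omega] (drift_norm theta).
Proof.
pose D : set (measurableTypeR R * Omega)%type := `[0%R, 1%R]%classic `*` setT.
have mD : measurable D by exact: measurableX.
pose f := ((fun sw : measurableTypeR R * Omega => (normv (theta sw.1 sw.2))%:E) \_ D).
have mf : measurable_fun [set: (measurableTypeR R * Omega)%type] f.
  apply/(measurable_restrictT _ mD)/measurable_EFinP.
  apply: (measurable_comp measurableT) => //; first exact: measurable_normv.
  exact: control_measurable.
have f0 sw : 0 <= f sw.
  by rewrite /f patchE; case: ifP => // _; rewrite lee_fin normv_ge0.
have := @measurable_fun_fubini_tonelli_G _ _ _ _ R leb f mf f0.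
congr measurable_fun; apply/funext => w; rewrite /fubini_G /drift_norm.
rewrite [RHS]integral_mkcond; apply: eq_integral => s _.
by rewrite /f !patchE /D in_setX/= (in_setT w) andbT.
Qed.

Lemma measurable_drift_coord (theta : control W) i : measurable_fun [set: Omega]
  (fun w => \int[lebesgue_measure]_(s in `[0%R, 1%R]) tnth (theta s w) i)%R.
Proof.
pose D : set (measurableTypeR R * Omega)%type := `[0%R, 1%R]%classic `*` setT.
have mD : measurable D by exact: measurableX.
pose f := ((fun sw : measurableTypeR R * Omega => (tnth (theta sw.1 sw.2) i)%:E) \_ D).
have mf : measurable_fun [set: (measurableTypeR R * Omega)%type] f.
  apply/(measurable_restrictT _ mD)/measurable_EFinP.
  apply: (measurable_comp measurableT (f := @tnth d R ^~ i)) => //.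
    exact: measurable_tnth.
  exact: control_measurable.
apply: (measurableT_comp (f := @fine R)); first exact: fine_measurable.
have -> : (fun w => \int[lebesgue_measure]_(s in `[0%R, 1%R])
                      (tnth (theta s w) i)%:E) =
          (fun w => fubini_G leb f^\+ w - fubini_G leb f^\- w).
  apply/funext => w; rewrite /fubini_G [LHS]integral_mkcond [LHS]integralE.
  congr (_ - _); apply: eq_integral => s _; rewrite ?funeposE ?funenegE.
    by rewrite /f !patchE /D in_setX/= (in_setT w) andbT.
  by rewrite /f !patchE /D in_setX/= (in_setT w) andbT.
apply: emeasurable_funB; apply: measurable_fun_fubini_tonelli_G => //.
- exact: measurable_funepos.
- exact: measurable_funeneg.
Qed.

Lemma measurable_state1 (theta : control W) :
  measurable_fun [set: Omega] (state theta 1).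
Proof.
apply/measurable_fun_tnthP => i.
rewrite (_ : _ \o _ = fun w => tnth x0 i
  + (\int[lebesgue_measure]_(s in `[0%R, 1%R]) tnth (theta s w) i)%R
  + tnth (W 1 w) i)%R; last first.
  by apply/funext => w; rewrite /= tnth_mktuple.
apply: measurable_funD; last exact: measurable_wiener_coord.
by apply: measurable_funD => //; exact: measurable_drift_coord.
Qed.

HB.instance Definition _ (theta : control W) :=
  isMeasurableFun.Build _ _ _ _ (state theta 1) (measurable_state1 theta).

Lemma measurable_control_coord (theta : control W) w i :
  measurable_fun (`[0%R, 1%R]%classic : set (measurableTypeR R))
    (fun s : measurableTypeR R => tnth (theta s w) i).
Proof.
apply: (measurable_comp measurableT (f := @tnth d R ^~ i)) => //.
  exact: measurable_tnth.
apply: (measurable_comp _ _ (control_measurable theta)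
  (g := fun s : measurableTypeR R => (s, w))) => //.
- exact: measurableX.
- by move=> _ [s s01 <-].
- by apply: measurable_funTS; exact: pair2_measurable.
Qed.

Lemma drift_coord_le (theta : control W) w i :
  ((\int[lebesgue_measure]_(s in `[0%R, 1%R]) tnth (theta s w) i)%R ^+ 2)%:E
  <= drift_norm theta w ^+ 2.
Proof.
set b := Rintegral _ _ _.
have bD : `|b|%:E <= drift_norm theta w.
  apply: (@le_trans _ _ `|\int[lebesgue_measure]_(s in `[0%R, 1%R])
                          (tnth (theta s w) i)%:E|).
    rewrite /b /Rintegral; case: (integral _ _ _) => //=.
    by rewrite normr0 leey.
    by rewrite normr0 leey.
  apply: (le_trans (le_abse_integral _ _ _)) => //.
    by apply/measurable_EFinP; exact: measurable_control_coord.
  apply: ge0_le_integral => //.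
  - apply: measurableT_comp => //.
    by apply/measurable_EFinP; exact: measurable_control_coord.
  - apply/measurable_EFinP.
    apply: (measurable_comp measurableT) => //; first exact: measurable_normv.
    apply: (measurable_comp _ _ (control_measurable theta)
      (g := fun s : measurableTypeR R => (s, w))) => //.
    + exact: measurableX.
    + by move=> _ [s s01 <-].
    + by apply: measurable_funTS; exact: pair2_measurable.
  - by move=> s _; rewrite lee_fin ler_norm_normv.
rewrite -(real_normK (num_real b)) expe2 expr2 EFinM.
by apply: lee_pmul.
Qed.

Definition terminal_state (theta : control W) : {RV P >-> d.-tuple R} :=
  state theta 1.

Lemma terminal_state_coord_sqr_integral (theta : control W) i :
  \int[P]_w (tnth (state theta 1 w) i ^+ 2)%:E < +oo.
Proof.
pose b w := (\int[lebesgue_measure]_(s in `[0%R, 1%R]) tnth (theta s w) i)%R.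
have mb : measurable_fun [set: Omega] b := measurable_drift_coord theta i.
have mD : measurable_fun [set: Omega] (fun w => drift_norm theta w ^+ 2).
  under [F in measurable_fun _ F]funext do rewrite expe2.
  by apply: emeasurable_funM; exact: measurable_drift_norm.
have mW : measurable_fun [set: Omega] (fun w => (tnth (W 1 w) i ^+ 2)%:E).
  by apply/measurable_EFinP/measurable_funX; exact: measurable_wiener_coord.
have D0 w : 0 <= drift_norm theta w ^+ 2.
  rewrite expe2 mule_ge0// /drift_norm; apply: integral_ge0 => s _;
  by rewrite lee_fin normv_ge0.
have W0 w : 0 <= (tnth (W 1 w) i ^+ 2)%:E by rewrite lee_fin sqr_ge0.
have c0 : 0 <= (3 * tnth x0 i ^+ 2)%:E by rewrite lee_fin mulr_ge0// sqr_ge0.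
apply: (@le_lt_trans _ _ (\int[P]_w ((3 * tnth x0 i ^+ 2)%:E +
    3%:E * (drift_norm theta w ^+ 2 + (tnth (W 1 w) i ^+ 2)%:E)))).
  apply: ge0_le_integral => //.
  - by move=> w _; rewrite lee_fin sqr_ge0.
  - apply/measurable_EFinP/measurable_funX.
    have /measurable_fun_tnthP/(_ i) := measurable_state1 theta; exact.
  - apply: emeasurable_funD => //; apply: emeasurable_funM => //.
    exact: emeasurable_funD.
  - move=> w _; rewrite /state tnth_mktuple -/(b w).
    apply: (@le_trans _ _ ((3 * tnth x0 i ^+ 2)%:E +
      3%:E * ((b w ^+ 2)%:E + (tnth (W 1 w) i ^+ 2)%:E))).
      rewrite -EFinD lee_fin.
      exact: sqr_sum3_le.
    by rewrite leeD2l// lee_pmul2l// leeD2r// drift_coord_le.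
rewrite ge0_integralD//; last 2 first.
- by move=> w _; rewrite mule_ge0// adde_ge0.
- by apply: emeasurable_funM => //; exact: emeasurable_funD.
rewrite integral_cst// [X in _ * X](_ : _ = 1)%E; last exact: probability_setT.
rewrite mule1 lte_add_pinfty ?ltry//.
rewrite ge0_integralZl//; last 2 first.
- exact: emeasurable_funD.
- by move=> w _; rewrite adde_ge0.
rewrite lte_mul_pinfty// ge0_integralD// lte_add_pinfty//.
  exact: control_integrable.
exact: wiener_coord_sqr_integral.
Qed.

Lemma terminal_law_second_moment (theta : control W) :
  second_moment (distribution P (terminal_state theta)) < +oo.
Proof.
rewrite /second_moment ge0_integral_distribution//; last 2 first.
- by apply/measurable_EFinP; exact: measurable_sqr_normv.
- by move=> x; rewrite lee_fin sqr_ge0.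
under eq_integral do rewrite /= sqr_normv -sumEFin.
rewrite ge0_integral_sum//.
- by apply: lte_sum_pinfty => i _; exact: terminal_state_coord_sqr_integral.
- move=> i; apply/measurable_EFinP/measurable_funX.
  by have /measurable_fun_tnthP/(_ i) := measurable_state1 theta.
- by move=> i w _; rewrite lee_fin sqr_ge0.
Qed.

Definition terminal_law (theta : control W) : P2 R d :=
  MkP2 (terminal_law_second_moment theta).

Variables (G : P2 R d -> R) (eps : R).

Definition cost (theta : control W) : \bar R :=
  (G (terminal_law theta))%:E +
  \int[P]_w ((eps / 2)%:E *
    \int[lebesgue_measure]_(s in `[0%R, 1%R]) (normv (theta s w) ^+ 2)%:E).

(* The value at time 0 and initial law \d_x0 *)
Definition value : \bar R := ereal_inf [set cost theta | theta in setT].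

End control.

(* Main.v *)
(* The infimum is tested on one explicit control, for which no stochastic
   calculus is needed. Round mu_star to a grid of step 2^-(m+1). Apply no
   control before time 1/2, and at time 1/2 use the Gaussian variable
   W_(1/2) - W_0 to draw a target Y having the rounded law. Then, from time
   1 - 2^-k to time 1 - 2^-(k+1), for k = 1, ..., m + 1, apply the constant
   drift that would bring the current state to Y at the end of the block: from
   the second block on it only has to correct the noise of the previous block,
   so each of these blocks costs O(d) in energy. The terminal state is
   Y + W_1 - W_t with t = 1 - 2^-(m+1), at distance O(sqrt (d 2^-m)) from Y,
   and the energy is O(1 + d m); take m of order (1 / alpha) ln (1 / eps). *)

Require Import Defs.
From mathcomp Require Import all_boot all_order all_algebra.
From mathcomp Require Import all_classical all_reals all_analysis.
From mathcomp Require Import measurable_realfun.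
From mathcomp Require Import ring lra.

Set Implicit Arguments.
Unset Strict Implicit.
Unset Printing Implicit Defensive.

Import Order.TTheory GRing.Theory Num.Theory.
Import numFieldNormedType.Exports.

Local Open Scope classical_set_scope.
Local Open Scope ring_scope.

(** * Second moment of a centred Gaussian law *)

(** With [y = x^2 / s^2], the density of deviation [s] is [2 exp (- 3 y / 8)] times that of
    deviation [2 s], and [y <= 3 exp (3 y / 8)]. So [x^2] times the former is at most [6 s^2] times
    the latter, whose mass is 1. *)
Lemma normal_prob_sqr_le (R : realType) (s : R) : 0 < s ->
  (\int[@normal_prob R 0 s]_x (x ^+ 2)%:E <= (6 * s ^+ 2)%:E)%E.
Proof.
move=> s0; have sn0 : s != 0 by rewrite gt_eqF.
have s2n0 : 2 * s != 0 by rewrite mulf_neq0.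
pose mu := @lebesgue_measure R.
pose nu : {finite_measure set (measurableTypeR R) -> \bar R} := @normal_prob R 0 s.
have numu : nu `<< mu by exact: normal_prob_dominates.
have mf : measurable_fun [set: R] (fun x : R => (x ^+ 2)%:E).
  by apply/measurable_EFinP; exact: exprn_measurable.
rewrite -(Radon_Nikodym_SigmaFinite.change_of_variables numu)//; last first.
  by move=> x; rewrite lee_fin sqr_ge0.
have mpdf r : measurable_fun [set: R] (fun x : R => (normal_pdf 0 r x)%:E).
  by apply/measurable_EFinP; exact: measurable_normal_pdf.
rewrite (@le_trans _ _ (\int[mu]_x ((6 * s ^+ 2)%:E *
    (normal_pdf 0 (2 * s) x)%:E))%E)//; last first.
  rewrite integralZl//; last exact: integrable_normal_pdf.
  by rewrite integral_normal_pdf mule1.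
rewrite (_ : (\int[mu]_x ((x ^+ 2)%:E * Radon_Nikodym_SigmaFinite.f nu mu x) =
  \int[mu]_x ((x ^+ 2)%:E * (normal_pdf 0 s x)%:E))%E); last first.
  apply: ae_eq_integral => //.
  - apply: emeasurable_funM => //; apply: (measurable_int mu).
    exact: Radon_Nikodym_SigmaFinite.f_integrable.
  - by apply: emeasurable_funM; [exact: mf|exact: mpdf].
  - apply: ae_eqe_mul2l => /=.
    apply: integral_ae_eq => //=.
    + exact: Radon_Nikodym_SigmaFinite.f_integrable.
    + exact: mpdf.
    + by move=> E _ mE; rewrite -Radon_Nikodym_SigmaFinite.f_integral.
apply: ge0_le_integral => //.
- by move=> x _; rewrite -EFinM lee_fin mulr_ge0// ?sqr_ge0// normal_pdf_ge0.
- by apply: emeasurable_funM; [exact: mf|exact: mpdf].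
- by apply: emeasurable_funM => //; exact: mpdf.
move=> x _; rewrite -!EFinM lee_fin !normal_pdfE//; move: (x : R) => {}x.
have -> : normal_peak s = 2 * normal_peak (2 * s) :> R.
  rewrite /normal_peak (_ : (2 * s) ^+ 2 * pi *+ 2 = 2 ^+ 2 * (s ^+ 2 * pi *+ 2));
    last by ring.
  rewrite sqrtrM ?sqr_ge0// sqrtr_sqr ger0_norm// invfM.
  by rewrite mulrA divff// mul1r.
rewrite [leLHS](_ : _ = normal_peak (2 * s) * (2 * (x ^+ 2 * normal_fun 0 s x)));
  last by ring.
rewrite [leRHS]mulrCA; apply: ler_wpM2l; first exact: normal_peak_ge0.
rewrite /normal_fun subr0.
have -> : - x ^+ 2 / (s ^+ 2 *+ 2) =
    - x ^+ 2 / ((2 * s) ^+ 2 *+ 2) - 3 / 8 * (x ^+ 2 / s ^+ 2) by field.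
set y := x ^+ 2 / s ^+ 2.
rewrite expRD expRN mulrCA mulrA mulrCA [in leRHS]mulrC.
apply: ler_wpM2l; first exact: expR_ge0.
rewrite ler_pdivrMr ?expR_gt0//.
have y0 : 0 <= y by rewrite divr_ge0// sqr_ge0.
have -> : x ^+ 2 = y * s ^+ 2 by rewrite /y divfK// sqrf_eq0.
have s2 : 0 <= s ^+ 2 by rewrite sqr_ge0.
have := ler_wpM2l s2 (expR_ge1Dx (3 / 8 * y)); have := mulr_ge0 y0 s2.
set E := expR _; move: (s ^+ 2) s2 => z; lra.
Qed.

(** * Simulation of a discrete law from a continuous real variable *)

Lemma measurable_preimage_nat d (T : measurableType d) (f : T -> nat) :
  (forall n, measurable (f @^-1` [set n])) -> forall B, measurable (f @^-1` B).
Proof.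
move=> mf B; rewrite (_ : _ @^-1` _ = \bigcup_(i in B) f @^-1` [set i]).
  by apply: bigcup_measurable => i _; exact: mf.
by apply/seteqP; split=> [x/= xn|x [i /= ni ->]//]; exists (f x).
Qed.

Section sampling.
Context {dO : measure_display} {Omega : measurableType dO} {R : realType}.
Context {P : probability Omega R} (X : {RV P >-> R}).
Hypothesis cdf_continuous : continuous (fun u => fine (cdf X u)).

Let Phi u := fine (cdf X u).

Let PhiE u : (Phi u)%:E = cdf X u.
Proof. by rewrite /Phi fineK// fin_num_measure. Qed.

Let PhiEP u : (Phi u)%:E = P (X @^-1` `]-oo, u]).
Proof. exact: PhiE. Qed.

Let Phi_nd u v : u <= v -> Phi u <= Phi v.
Proof. by move=> uv; rewrite -lee_fin !PhiE; exact: cdf_nondecreasing. Qed.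

(** The limits 0 and 1 at the two infinities give values on both sides of [p]; the intermediate
    value theorem does the rest. *)
Let Phi_surj (p : R) : 0 < p < 1 -> exists a, Phi a = p.
Proof.
move=> /andP[p0 p1].
have [a Pa] : exists a, Phi a < p.
  have : (fine \o cdf X) @ -oo --> (0 : R) by exact/fine_cvg/cvg_cdfNy0.
  move=> /cvgr_lt/(_ p p0)[M [_ HM]]; exists (M - 1); apply: HM.
  by rewrite ltrBlDr ltrDl.
have [b Pb] : exists b, p < Phi b.
  have : (fine \o cdf X) @ +oo --> (1 : R) by exact/fine_cvg/cvg_cdfy1.
  move=> /cvgr_gt/(_ p p1)[M [_ HM]]; exists (M + 1); apply: HM.
  by rewrite ltrDl.
have ab : a <= b.
  by rewrite leNgt; apply/negP => /ltW/Phi_nd; rewrite leNgt (lt_trans Pa Pb).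
have cPhi : {within `[a, b], continuous Phi}.
  by apply: continuous_subspaceT => x; exact: cdf_continuous.
have [|c _ Hc] := IVT ab cPhi (v := p); last by exists c.
by rewrite (min_idPl (Phi_nd ab)) (max_idPr (Phi_nd ab)) (ltW Pa) (ltW Pb).
Qed.

Let measurable_Phi (p : R) : measurable [set u | Phi u <= p].
Proof.
rewrite -[X in measurable X]setTI (_ : [set u | _] = Phi @^-1` `]-oo, p]); last first.
  by apply/seteqP; split => u /=; rewrite in_itv.
by apply: nondecreasing_measurable => //= u v; exact: Phi_nd.
Qed.

(* The lower bound comes from the intermediate value theorem; the upper bound
   holds because, for every [q > p], the event [Phi X <= p] lies to the left of
   a point where [Phi = q]. *)
Lemma probability_integral_transform (p : R) : 0 <= p <= 1 ->
  P (X @^-1` [set u | Phi u <= p]) = p%:E.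
Proof.
move=> /andP[p0 p1].
have mS : measurable (X @^-1` [set u | Phi u <= p]).
  by apply: measurable_funPTI.
apply/eqP; rewrite eq_le; apply/andP; split; last first.
  (* [Phi] need not attain 0 or 1, so these two levels are treated apart. *)
  have [->|pn0] := eqVneq p 0; first exact: measure_ge0.
  have [->|pn1] := eqVneq p 1.
    rewrite (_ : X @^-1` _ = setT) ?probability_setT//.
    apply/seteqP; split=> // w _ /=.
    by rewrite -lee_fin PhiE cdf_le1.
  have [|a Pa] := @Phi_surj p; first by rewrite !lt_neqAle eq_sym pn0 p0 pn1 p1.
  rewrite (_ : _%:E = P (X @^-1` `]-oo, a])); last by rewrite -Pa PhiEP.
  apply: le_measure; rewrite ?inE//; first exact: measurable_funPTI.
  move=> w /=; rewrite in_itv/= => wa.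
  by rewrite -Pa; exact: Phi_nd.
have [pE|pn1] := eqVneq p 1; first by rewrite [leRHS](congr1 EFin pE) probability_le1.
have {pn1}p1 : p < 1 by rewrite lt_neqAle pn1.
apply/lee_addgt0Pr => e e0.
(* The cap at the midpoint of [p] and 1 keeps [q] below 1, so that [Phi] attains it. *)
pose q := Num.min (p + e) ((p + 1) / 2).
have pq : p < q by rewrite lt_min ltrDl e0/=; lra.
have q1 : q < 1 by rewrite gt_min; apply/orP; right; lra.
have [|a Pa] := @Phi_surj q; first by rewrite (le_lt_trans p0 pq).
apply: (@le_trans _ _ q%:E); last by rewrite -EFinD lee_fin ge_min lexx.
rewrite (_ : q%:E = P (X @^-1` `]-oo, a])); last by rewrite -Pa PhiEP.
apply: le_measure; rewrite ?inE//; first exact: measurable_funPTI.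
move=> w /= wp; rewrite in_itv/= leNgt; apply/negP => /ltW/Phi_nd.
by rewrite Pa leNgt (le_lt_trans wp pq).
Qed.

Context {d : measure_display} {T : measurableType d} (mu : probability T R).
Variable (c : T -> nat).
Hypothesis mc : forall n, measurable (c @^-1` [set n]).

Let F n : R := fine (mu (c @^-1` `I_n)).

Let mcI n : measurable (c @^-1` `I_n).
Proof. exact: measurable_preimage_nat. Qed.

Let FE n : (F n)%:E = mu (c @^-1` `I_n).
Proof. by rewrite fineK// fin_num_measure. Qed.

Let F_nd m n : (m <= n)%N -> F m <= F n.
Proof.
move=> mn; rewrite -lee_fin !FE; apply: le_measure; rewrite ?inE//.
by move=> x /= /leq_trans; exact.
Qed.

(* Quantile map of the law of [c]: [F n] is the mass of [{0, ..., n - 1}]. The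
   junk value 0 is only taken on a null set. *)
Let N (u : R) : nat :=
  if pselect (exists n, Phi u <= F n.+1) is left e then ex_minn e else 0%N.

(** Only an inclusion: for [n = 0] the fibre of [N] also contains the points where
    [Phi u <= F 0 = 0] and the junk points. *)
Let N_ge n : [set u | Phi u <= F n.+1] `\` [set u | Phi u <= F n] `<=`
  N @^-1` [set n].
Proof.
move=> u [/= un nun]; rewrite /N; case: pselect => [e|]; last by case; exists n.
case: ex_minnP => m um minm.
apply/eqP; rewrite eqn_leq minm//= leqNgt; apply/negP => mn.
by apply: nun; rewrite (le_trans um)// F_nd.
Qed.

Let measurable_N B : measurable (N @^-1` B).
Proof.
(* The fibre over 0 is the first sublevel set together with the junk set, the complement of all
   sublevel sets; the other fibres are differences of consecutive sublevel sets. *)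
apply: measurable_preimage_nat => -[|n].
  rewrite (_ : _ @^-1` _ = [set u | Phi u <= F 1] `|`
      ~` \bigcup_i [set u | Phi u <= F i.+1]).
    apply: measurableU; first exact: measurable_Phi.
    by apply/measurableC/bigcupT_measurable => i; exact: measurable_Phi.
  apply/seteqP; split=> u /=; rewrite /N; case: pselect => [e|ne].
  - by case: ex_minnP => m um _ m0; left; rewrite m0 in um.
  - by move=> _; right => -[i _ ui]; apply: ne; exists i.
  - case=> [u1|[]]; last by case: e => i ui; exists i.
    by case: ex_minnP => m _ /(_ 0%N u1); rewrite leqn0 => /eqP.
  - by [].
rewrite (_ : _ @^-1` _ =
    [set u | Phi u <= F n.+2] `\` [set u | Phi u <= F n.+1]).
  by apply: measurableD; exact: measurable_Phi.
apply/seteqP; split => u; last exact: N_ge.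
rewrite /= /N; case: pselect => // e; case: ex_minnP => m um minm mn.
by split => /= [|/minm]; [rewrite -mn|rewrite mn ltnn].
Qed.

(** By the probability integral transform, [Phi X] falls between [F n] (excluded) and [F n.+1] with
    probability [F n.+1 - F n], the mass of the event [c = n]. *)
Let N_singleton_ge n : (mu (c @^-1` [set n]) <= P (X @^-1` (N @^-1` [set n])))%E.
Proof.
have F01 i : 0 <= F i <= 1.
  by rewrite fine_ge0//= -lee_fin FE probability_le1.
apply: (@le_trans _ _ (P (X @^-1`
    ([set u | Phi u <= F n.+1] `\` [set u | Phi u <= F n])))); last first.
  apply: le_measure; rewrite ?inE.
  - by apply: measurable_funPTI; apply: measurableD; exact: measurable_Phi.
  - by apply: measurable_funPTI; exact: measurable_N.
  - by move=> w; exact: N_ge.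
rewrite [X in (_ <= P X)%E](_ : _ = X @^-1` [set u | Phi u <= F n.+1] `\`
  X @^-1` [set u | Phi u <= F n])// measureD; last 3 first.
- by apply: measurable_funPTI; exact: measurable_Phi.
- by apply: measurable_funPTI; exact: measurable_Phi.
- by rewrite (le_lt_trans (probability_le1 _ _)) ?ltry//;
    apply: measurable_funPTI; exact: measurable_Phi.
rewrite setIidr; last first.
  by move=> w /=; move=> /le_trans; apply; exact: F_nd.
rewrite [leRHS](_ : _ = mu (c @^-1` `I_n.+1) - mu (c @^-1` `I_n))%E; last first.
  by rewrite -!FE; congr (_ - _)%E; exact: probability_integral_transform.
rewrite (_ : c @^-1` [set n] = c @^-1` `I_n.+1 `\` c @^-1` `I_n).
  rewrite measureD//; last by rewrite (le_lt_trans (probability_le1 _ _)) ?ltry.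
  by rewrite setIidr// => x /=; exact: ltnW.
apply/seteqP; split=> x /=; first by move=> ->; rewrite ltnn.
by move=> [xn /negP]; rewrite -leqNgt => nx; apply/eqP; rewrite eqn_leq nx -ltnS xn.
Qed.

(* The law of [N X] dominates that of [c] on singletons, hence on every set; as
   both are probabilities, they coincide. *)
Lemma simulation : exists N : R -> nat,
  (forall B, measurable (N @^-1` B)) /\
  (forall B, P (X @^-1` (N @^-1` B)) = mu (c @^-1` B)).
Proof.
exists N; split => [//|].
have mcB B : measurable (c @^-1` B) by exact: measurable_preimage_nat.
have mXB B : measurable (X @^-1` (N @^-1` B)) by exact: measurable_funPTI.
have ge B : (mu (c @^-1` B) <= P (X @^-1` (N @^-1` B)))%E.
  have -> : c @^-1` B = \bigcup_(i in B) c @^-1` [set i].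
    by apply/seteqP; split=> [x/= xn|x [i /= ni ->]//]; exists (c x).
  have -> : X @^-1` (N @^-1` B) = \bigcup_(i in B) X @^-1` (N @^-1` [set i]).
    by apply/seteqP; split=> [x/= xn|x [i /= ni ->]//]; exists (N (X x)).
  rewrite !measure_bigcup//.
  - by apply: lee_nneseries => // i _; exact: N_singleton_ge.
  - by move=> i j _ _ [w [/= <- <-]].
  - by move=> i j _ _ [w [/= <- <-]].
move=> B; apply/eqP; rewrite eq_le ge andbT.
have : (mu (~` (c @^-1` B)) <= P (~` (X @^-1` (N @^-1` B))))%E := ge (~` B).
rewrite probability_setC// [in leRHS]probability_setC//.
rewrite -[mu _]fineK ?fin_num_measure// -[P (X @^-1` _)]fineK ?fin_num_measure//.
by rewrite -!EFinB !lee_fin lerD2l lerN2.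
Qed.

End sampling.

(** * Measurability and quadratic inequalities for vectors *)

Section euclidean.
Context {R : realType} {d : nat}.

Lemma measurable_subv d' (T : measurableType d') (X Y : T -> d.-tuple R) :
  measurable_fun setT X -> measurable_fun setT Y ->
  measurable_fun setT (fun w => subv (X w) (Y w)).
Proof.
move=> mX mY; apply/measurable_fun_tnthP => i.
rewrite (_ : _ \o _ = fun w => tnth (X w) i - tnth (Y w) i); last first.
  by apply/funext => w; rewrite /= tnth_mktuple.
by apply: measurable_funB; apply: (measurableT_comp (f := @tnth d R ^~ i)) => //;
  exact: measurable_tnth.
Qed.

Lemma measurable_fun_sqr_normv d' (T : measurableType d') (X : T -> d.-tuple R) :
  measurable_fun setT X ->
  measurable_fun setT (fun w => (normv (X w) ^+ 2)%:E : \bar R).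
Proof.
move=> mX; apply/measurable_EFinP.
by apply: (measurableT_comp (f := fun x => normv x ^+ 2));
  first exact: measurable_sqr_normv.
Qed.

Lemma measurable_sqr_dist d' (T : measurableType d') (X Y : T -> d.-tuple R) :
  measurable_fun setT X -> measurable_fun setT Y ->
  measurable_fun setT (fun w => (normv (subv (X w) (Y w)) ^+ 2)%:E).
Proof. by move=> mX mY; apply/measurable_fun_sqr_normv/measurable_subv. Qed.

Definition scalev (a : R) (x : d.-tuple R) : d.-tuple R :=
  [tuple a * tnth x i | i < d].

Lemma sqr_normv_scalev (a : R) (x : d.-tuple R) :
  normv (scalev a x) ^+ 2 = a ^+ 2 * normv x ^+ 2.
Proof.
rewrite !sqr_normv mulr_sumr; apply: eq_bigr => i _.
by rewrite tnth_mktuple exprMn.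
Qed.

Lemma sqr_normv_subv_le (x y : d.-tuple R) :
  normv (subv x y) ^+ 2 <= 2 * normv x ^+ 2 + 2 * normv y ^+ 2.
Proof.
rewrite !sqr_normv !mulr_sumr -big_split; apply: ler_sum => i _.
rewrite tnth_mktuple /=.
have := sqr_ge0 (tnth x i + tnth y i).
nra.
Qed.

(** This is [(a + b)^2 <= 2 a^2 + 2 b^2] in each coordinate, a form suited to integration. *)
Lemma sqr_dist_triangle (x y z : d.-tuple R) :
  normv (subv z x) ^+ 2 <= 2 * normv (subv x y) ^+ 2 + 2 * normv (subv y z) ^+ 2.
Proof.
rewrite !sqr_normv !mulr_sumr -big_split; apply: ler_sum => i _.
rewrite !tnth_mktuple /=.
have := sqr_ge0 ((tnth x i - tnth y i) - (tnth y i - tnth z i)).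
nra.
Qed.

Lemma sqr_normv_subvC (x y : d.-tuple R) :
  normv (subv x y) ^+ 2 = normv (subv y x) ^+ 2.
Proof.
by rewrite !sqr_normv; apply: eq_bigr => i _; rewrite !tnth_mktuple -sqrrN opprB.
Qed.

End euclidean.

(** * Gaussian distribution functions and Wiener increments *)

(** The density is bounded by its peak, so the distribution function is Lipschitz. This allows
    sampling from a Gaussian increment. *)
Lemma normal_cdf_continuous dO (Omega : measurableType dO) (R : realType)
    (P : probability Omega R) (X : {RV P >-> R}) (s : R) : 0 < s ->
  (forall B, measurable B -> P (X @^-1` B) = normal_prob 0 s B) ->
  continuous (fun u => fine (cdf X u)).
Proof.
move=> s0 PX; have sn0 : s != 0 by rewrite gt_eqF.
pose F u := fine (cdf X u).
pose K := normal_peak s.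
have K0 : 0 < K by exact: normal_peak_gt0.
have FE u : (F u)%:E = normal_prob 0 s `]-oo, u].
  by rewrite fineK ?fin_num_measure//; exact: PX.
have FL u v : u <= v -> 0 <= F v - F u <= K * (v - u).
  move=> uv; rewrite -!lee_fin EFinB !FE.
  have -> : (normal_prob 0 s `]-oo, v] - normal_prob 0 s `]-oo, u] =
      normal_prob 0 s `]u, v])%E.
    rewrite (@itv_bndbnd_setU _ _ _ (BRight u))//= measureU//=; last first.
      by apply/seteqP; split=> // x [] /=; rewrite !in_itv/= leNgt => /negbTE ->.
    by rewrite addeAC subee ?add0e// fin_num_measure.
  rewrite measure_ge0/= /normal_prob.
  apply: (@le_trans _ _ (\int[lebesgue_measure]_(x in `]u, v]) K%:E)%E).
    apply: ge0_le_integral => //.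
    - by move=> x _; rewrite lee_fin normal_pdf_ge0.
    - by apply/measurable_EFinP/measurable_funTS; exact: measurable_normal_pdf.
    - by move=> x _; rewrite lee_fin normal_pdf_ub.
  rewrite integral_cst//= lebesgue_measure_itv/= lte_fin.
  case: ifPn => _; first by rewrite -EFinB -EFinM.
  by rewrite mule0 lee_fin mulr_ge0 ?subr_ge0// ltW.
have FLn u v : `|F u - F v| <= K * `|u - v|.
  have [uv|/ltW uv] := leP u v.
    have /andP[F0 F1] := FL _ _ uv.
    by rewrite distrC ger0_norm// distrC ger0_norm// subr_ge0.
  have /andP[F0 F1] := FL _ _ uv.
  by rewrite ger0_norm// ger0_norm// subr_ge0.
move=> x; apply/cvgrPdist_le => e e0; near=> y.
rewrite (le_trans (FLn _ _))// -ler_pdivlMl// mulrC.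
near: y; apply: cvgr_dist_le => //; exact: divr_gt0.
Unshelve. all: by end_near. Qed.

Section wiener_increments.
Context {dO : measure_display} {Omega : measurableType dO} {R : realType}.
Context {d : nat} {P : probability Omega R} (W : wiener P d).

(** [wiener_normal] is applied to a box whose sides other than the [i]-th are the whole line and
    contribute factors 1. *)
Lemma wiener_coord_normal (s t : R) (i : 'I_d) B : 0 <= s -> s < t -> measurable B ->
  P [set w | B (tnth (W t w) i - tnth (W s w) i)] =
  normal_prob 0 (Num.sqrt (t - s)) B.
Proof.
move=> s0 st mB.
pose A (j : 'I_d) : set R := if j == i then B else setT.
have mA j : measurable (A j) by rewrite /A; case: ifP.
have := wiener_normal W s0 st mA.
rewrite (bigD1 i)//= big1 ?mule1; last first.
  by move=> j /negbTE ji; rewrite /A ji probability_setT.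
rewrite {2}/A eqxx => <-; congr (P _); apply/seteqP; split => w /=.
  by rewrite /A => Bw j; case: ifP => // /eqP ->; rewrite tnth_mktuple.
by move=> /(_ i); rewrite /A eqxx tnth_mktuple.
Qed.

Lemma wiener_increment_sqr_le (s t : R) : 0 <= s -> s < t ->
  (\int[P]_w (normv (subv (W t w) (W s w)) ^+ 2)%:E <= (d%:R * (6 * (t - s)))%:E)%E.
Proof.
move=> s0 st.
under eq_integral do rewrite sqr_normv -sumEFin.
have mX i : measurable_fun setT (fun w => tnth (W t w) i - tnth (W s w) i).
  by apply: measurable_funB; exact: measurable_wiener_coord.
have mW i : measurable_fun setT (fun w => (tnth (subv (W t w) (W s w)) i ^+ 2)%:E).
  apply/measurable_EFinP/measurable_funX.
  under [F in measurable_fun _ F]funext do rewrite tnth_mktuple.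
  exact: mX.
rewrite ge0_integral_sum//; last by move=> i w _; rewrite lee_fin sqr_ge0.
have -> : (d%:R * (6 * (t - s)))%:E = \sum_(i < d) (6 * (t - s))%:E :> \bar R.
  by rewrite sumEFin sumr_const card_ord mulr_natl.
apply: lee_sum => i _; under eq_integral do rewrite tnth_mktuple.
have mf : measurable_fun [set: R] (fun x : R => (x ^+ 2)%:E).
  by apply/measurable_EFinP; exact: exprn_measurable.
have := @ge0_integral_pushforward _ _ _ (measurableTypeR R) R _ (mX i) P _ _
  measurableT mf.
rewrite preimage_setT => <-; last by move=> x _; rewrite lee_fin sqr_ge0.
rewrite (eq_measure_integral (normal_prob 0 (Num.sqrt (t - s)))); last first.
- by move=> ? B mB _; have := wiener_coord_normal i s0 st mB.
- exact: mX.
have ts0 : 0 < t - s by rewrite subr_gt0.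
by rewrite -{3}(sqr_sqrtr (ltW ts0)); apply: normal_prob_sqr_le; rewrite sqrtr_gt0.
Qed.

Lemma wiener_sqr_le (t : R) : 0 < t ->
  (\int[P]_w (normv (W t w) ^+ 2)%:E <= (d%:R * (6 * t))%:E)%E.
Proof.
move=> t0; have := wiener_increment_sqr_le (lexx 0) t0; rewrite subr0.
apply: le_trans; rewrite le_eqVlt; apply/orP; left; apply/eqP.
have mW u : measurable_fun setT (W u) by exact: measurable_funPT.
apply: ge0_ae_eq_integral => //.
- exact: measurable_fun_sqr_normv.
- exact: measurable_sqr_dist.
- by move=> w _; rewrite lee_fin sqr_ge0.
- by move=> w _; rewrite lee_fin sqr_ge0.
have := wiener_zero W; apply: filterS => w Ww0 _.
rewrite !sqr_normv; congr EFin; apply: eq_bigr => i _.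
by rewrite tnth_mktuple Ww0 subr0.
Qed.

End wiener_increments.

(** * Measurability with respect to the natural filtration *)

Section filtrations.
Context {dO : measure_display} {Omega : measurableType dO} {R : realType}.
Context {d : nat} {P : probability Omega R} (W : R -> {RV P >-> d.-tuple R}).

Lemma natural_filtration_measurable t A :
  natural_filtration W t A -> measurable A.
Proof.
apply: smallest_sub; first exact: sigma_algebra_measurable.
move=> _ [u _ [B mB <-]]; rewrite setTI; exact: measurable_funPTI.
Qed.

Lemma natural_filtration_nondecreasing s t : s <= t ->
  natural_filtration W s `<=` natural_filtration W t.
Proof.
move=> st; apply: sub_sigma_algebra2; apply: bigcup_sub => u.
rewrite /= in_itv/= => /andP[u0 us]; apply: (bigcup_sup (i := u)) => /=.
by rewrite in_itv/= u0 (le_trans us st).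
Qed.

Lemma natural_filtration_augmented t :
  natural_filtration W t `<=` augmented_filtration W t.
Proof. by move=> A FA; apply: sub_sigma_algebra; left. Qed.

Definition filtered_space t : measurableType _ :=
  g_sigma_algebraType
    (\bigcup_(u in `[0, t]) preimage_set_system setT (W u) measurable).

Lemma measurable_process u t : 0 <= u <= t ->
  measurable_fun [set: filtered_space t] (W u).
Proof.
by move=> ut _ B mB; rewrite setTI; apply: sub_sigma_algebra; exists u => //;
  exists B => //; rewrite setTI.
Qed.

Lemma measurable_natural_filtration t d' (T : measurableType d')
    (X : Omega -> T) :
  measurable_fun [set: filtered_space t] X ->
  forall A, measurable A -> natural_filtration W t (X @^-1` A).
Proof. by move=> mX A mA; have := mX measurableT A mA; rewrite setTI. Qed.

End filtrations.

(** * Piecewise constant controls *)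

Section step_control.
Context {dO : measure_display} {Omega : measurableType dO} {R : realType}.
Context {d : nat} {P : probability Omega R} (W : wiener P d).
Variables (n : nat) (t : nat -> R) (xi : nat -> Omega -> d.-tuple R).
Hypotheses (t0_ge0 : 0 <= t 0) (t_nd : {homo t : i j / (i <= j)%N >-> i <= j}).
Hypothesis t_le1 : forall k, t k <= 1.
Hypothesis xi_adapted : forall k A, measurable A ->
  natural_filtration W (t k) (xi k @^-1` A).
Hypothesis xi_sqr_integral : forall k,
  (\int[P]_w (normv (xi k w) ^+ 2)%:E < +oo)%E.

Let t_ge0 k : 0 <= t k.
Proof. exact: (le_trans t0_ge0 (t_nd _)). Qed.

(** Blocks are closed on the left, so that the value [xi k] in force at time [s] is known since
    [t k <= s]. Outside all blocks, [None] makes the control vanish. *)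
Definition step_index (s : R) : option 'I_n :=
  [pick k : 'I_n | t k <= s < t k.+1].

Definition step (s : R) (w : Omega) : d.-tuple R :=
  if step_index s is Some k then xi k w else [tuple 0 | i < d].

Let I k : set (measurableTypeR R) := `[t k, t k.+1[%classic.

Let mI k : measurable (I k).
Proof. exact: measurable_itv. Qed.

Let lebesgue_measure_I k : lebesgue_measure (I k) = (t k.+1 - t k)%:E.
Proof.
rewrite /I lebesgue_measure_itv/= lte_fin; have := t_nd (leqnSn k).
by rewrite le_eqVlt => /orP[/eqP ->|->//]; rewrite ltxx subrr.
Qed.

Let measurable_I k :
  measurable_fun setT (\1_(I k) : measurableTypeR R -> R).
Proof. by apply/measurable_indicP. Qed.

(** Monotonicity of [t] makes the blocks disjoint, so at most one term survives. An arbitrary [a] is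
    allowed because coordinates, squared norms and norms are substituted in turn; this makes even
    the norm of the control a linear combination of indicators. *)
Let step_indexE s (a : nat -> R) :
  (if step_index s is Some k then a k else 0) = \sum_(k < n) \1_(I k) s * a k.
Proof.
rewrite /step_index; case: pickP => [k /andP[ks sk]|none].
  rewrite (bigD1 k)//= indicE mem_set ?mul1r; last by rewrite /I/= in_itv/= ks.
  rewrite big1 ?addr0// => j jk; rewrite indicE memNset ?mul0r// /I/= in_itv/=.
  move=> /andP[js sj]; move: jk; rewrite -val_eqE/= neq_ltn => /orP[jk|kj].
    by have := t_nd jk; rewrite leNgt (le_lt_trans ks sj).
  by have := t_nd kj; rewrite leNgt (le_lt_trans js sk).
rewrite big1// => k _; rewrite indicE memNset ?mul0r// /I/= in_itv/= => ks.
by have := none k; rewrite ks.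
Qed.

Let step_coordE s w i :
  tnth (step s w) i = \sum_(k < n) \1_(I k) s * tnth (xi k w) i.
Proof.
rewrite -(step_indexE s (fun k => tnth (xi k w) i)) /step.
by case: step_index => //; rewrite tnth_mktuple.
Qed.

Let step_sqrE s w :
  normv (step s w) ^+ 2 = \sum_(k < n) \1_(I k) s * normv (xi k w) ^+ 2.
Proof.
rewrite -(step_indexE s (fun k => normv (xi k w) ^+ 2)) /step.
case: step_index => [//|].
by rewrite sqr_normv big1// => i _; rewrite tnth_mktuple expr0n.
Qed.

Let step_normE s w :
  normv (step s w) = \sum_(k < n) \1_(I k) s * normv (xi k w).
Proof.
rewrite -(step_indexE s (fun k => normv (xi k w))) /step.
case: step_index => [//|].
by rewrite /normv big1 ?sqrtr0// => i _; rewrite tnth_mktuple expr0n.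
Qed.

Let measurable_xi k : measurable_fun setT (xi k).
Proof.
by move=> _ A mA; rewrite setTI; apply: natural_filtration_measurable;
  exact: xi_adapted.
Qed.

Let measurable_xi_coord k i : measurable_fun setT (fun w => tnth (xi k w) i).
Proof.
apply: (measurableT_comp (f := @tnth d R ^~ i)) => //; exact: measurable_tnth.
Qed.

Let measurable_xi_sqr k :
  measurable_fun setT (fun w => (normv (xi k w) ^+ 2)%:E).
Proof. exact: measurable_fun_sqr_normv. Qed.

Let step_measurable : measurable_fun
    (`[0%R, 1%R]%classic `*` setT : set (measurableTypeR R * Omega)%type)
    (fun sw : measurableTypeR R * Omega => step sw.1 sw.2).
Proof.
apply: measurable_funTS; apply/measurable_fun_tnthP => i.
under [F in measurable_fun _ F]funext do rewrite /= step_coordE.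
apply: measurable_sum => k; apply: measurable_funM.
  apply: (measurableT_comp (f := \1_(I k) : measurableTypeR R -> R)).
    exact: measurable_I.
  exact: measurable_fst.
apply: (measurableT_comp (f := fun w => tnth (xi k w) i)).
  exact: measurable_xi_coord.
exact: measurable_snd.
Qed.

Let step_adapted s : 0 <= s <= 1 -> forall A, measurable A ->
  augmented_filtration W s (step s @^-1` A).
Proof.
move=> _ A mA; apply: natural_filtration_augmented.
rewrite /step /step_index; case: pickP => [k /andP[ks _]|_].
  by apply: (natural_filtration_nondecreasing ks); exact: xi_adapted.
rewrite preimage_cst; case: ifP => _; last exact: (@measurable0 _ (filtered_space W s)).
exact: (@measurableT _ (filtered_space W s)).
Qed.

Let integrable_indic_I k :
  (lebesgue_measure : measure (measurableTypeR R) R).-integrable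
    `[0, 1]%classic (EFin \o \1_(I k)).
Proof.
apply/integrableP; split; first exact/measurable_EFinP/measurable_funTS.
under eq_integral do rewrite /= ger0_norm//.
rewrite integral_indic//; apply: (@le_lt_trans _ _ (lebesgue_measure (I k))).
  by apply: le_measure; rewrite ?inE//; exact: measurableI.
by rewrite lebesgue_measure_I ltry.
Qed.

Let integral_indic_sum (a : nat -> R) :
  (\int[lebesgue_measure]_(s in `[0%R, 1%R])
     (\sum_(k < n) \1_(I k) s * a k)%:E =
   (\sum_(k < n) (t k.+1 - t k) * a k)%:E)%E.
Proof.
under eq_integral do rewrite -sumEFin.
rewrite integral_sum//; last first.
  move=> k; apply: (@eq_integrable _ _ _ _ _ _
    (fun s => (a k)%:E * (\1_(I k) s)%:E)%E) => // [s _|].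
    by rewrite -EFinM mulrC.
  by apply: integrableZl => //; exact: integrable_indic_I.
rewrite -sumEFin; apply: eq_bigr => k _.
under eq_integral do rewrite EFinM.
rewrite integralZr//; last exact: integrable_indic_I.
rewrite integral_indic// EFinM; congr (_ * _)%E.
rewrite setIidl; last first.
  move=> s; rewrite /I/= !in_itv/= => /andP[ks sk].
  by rewrite (le_trans (t_ge0 k))//= (le_trans (ltW sk)).
exact: lebesgue_measure_I.
Qed.

(** Let [S] be the sum of all squared norms. Each norm is at most [sqrt S] and the block lengths
    telescope to at most 1, so the squared time integral is at most [S], which is integrable. *)
Let step_integrable :
  (\int[P]_w (\int[lebesgue_measure]_(s in `[0%R, 1%R])
     (normv (step s w))%:E) ^+ 2 < +oo)%E.
Proof.
pose S w := \sum_(k < n) normv (xi k w) ^+ 2.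
have S0 w : 0 <= S w by apply: sumr_ge0 => k _; exact: sqr_ge0.
apply: (@le_lt_trans _ _ (\int[P]_w (S w)%:E)%E); last first.
  under eq_integral do rewrite -sumEFin.
  rewrite ge0_integral_sum//; last by move=> k w _; rewrite lee_fin sqr_ge0.
  by apply: lte_sum_pinfty => k _; exact: xi_sqr_integral.
under eq_integral => w _.
  under eq_integral do rewrite step_normE.
  rewrite (integral_indic_sum (fun k => normv (xi k w))) -EFin_expe.
  over.
apply: ge0_le_integral => //.
- by move=> w _; rewrite lee_fin sqr_ge0.
- apply/measurable_EFinP/measurable_funX/measurable_sum => k.
  apply: measurable_funM => //; apply: measurableT_comp => //.
  exact: measurable_normv.
- apply/measurable_EFinP/measurable_sum => k.
  by have /measurable_EFinP := measurable_xi_sqr k.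
move=> w _; rewrite lee_fin -[leRHS]sqr_sqrtr// ler_sqr ?nnegrE ?sqrtr_ge0//; last first.
  by apply: sumr_ge0 => k _; rewrite mulr_ge0 ?normv_ge0// subr_ge0 t_nd.
apply: (@le_trans _ _ (\sum_(k < n) (t k.+1 - t k) * Num.sqrt (S w))).
  apply: ler_sum => k _; rewrite ler_wpM2l ?subr_ge0 ?t_nd//.
  rewrite -[leLHS]ger0_norm ?normv_ge0// -sqrtr_sqr ler_wsqrtr//.
  by rewrite /S (bigD1 k)//= lerDl sumr_ge0// => j _; exact: sqr_ge0.
rewrite -mulr_suml -(big_mkord xpredT (fun k => t k.+1 - t k)) telescope_sumr//.
by rewrite ler_piMl ?sqrtr_ge0// (le_trans _ (t_le1 n))// gerBl.
Qed.

Definition step_control : control W :=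
  MkControl step_measurable step_adapted step_integrable.

Lemma step_control_drift w i :
  (\int[lebesgue_measure]_(s in `[0%R, 1%R]) tnth (step_control s w) i)%R =
  \sum_(k < n) (t k.+1 - t k) * tnth (xi k w) i.
Proof.
rewrite /Rintegral/=; under eq_integral do rewrite step_coordE.
by rewrite (integral_indic_sum (fun k => tnth (xi k w) i)).
Qed.

Lemma step_control_energy (a : R) : 0 <= a ->
  (\int[P]_w (a%:E * \int[lebesgue_measure]_(s in `[0%R, 1%R])
    (normv (step_control s w) ^+ 2)%:E) =
  a%:E * \sum_(k < n) (t k.+1 - t k)%:E * \int[P]_w (normv (xi k w) ^+ 2)%:E)%E.
Proof.
move=> a0; under eq_integral => w _.
  rewrite /=; under eq_integral do rewrite step_sqrE.
  rewrite (integral_indic_sum (fun k => normv (xi k w) ^+ 2)) -sumEFin.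
  over.
have mS k : measurable_fun setT
    (fun w => ((t k.+1 - t k) * normv (xi k w) ^+ 2)%:E).
  under eq_fun do rewrite EFinM.
  by apply: emeasurable_funM => //; exact: measurable_cst.
have S0 k w : (0 <= ((t k.+1 - t k) * normv (xi k w) ^+ 2)%:E)%E.
  by rewrite lee_fin mulr_ge0 ?sqr_ge0// subr_ge0 t_nd.
rewrite ge0_integralZl//; last 2 first.
- exact: emeasurable_sum.
- by move=> w _; exact: sume_ge0.
rewrite ge0_integral_sum//; congr (_ * _)%E.
apply: eq_bigr => k _; under eq_integral do rewrite EFinM.
rewrite ge0_integralZl//.
- by move=> w _; rewrite lee_fin sqr_ge0.
- by rewrite lee_fin subr_ge0 t_nd.
Qed.

End step_control.

(** * Couplings and the Wasserstein distance *)

Section coupling.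
Context {R : realType} {d : nat}.

(** The joint law of [X] and [Y] is a coupling whose cost is the expected squared distance. *)
Lemma W2_le d' (T : measurableType d') (Q : probability T R)
    (mu nu : probability (d.-tuple R) R) (X Y : {RV Q >-> d.-tuple R}) (c : R) :
  (forall A, measurable A -> Q (X @^-1` A) = mu A) ->
  (forall A, measurable A -> Q (Y @^-1` A) = nu A) ->
  (\int[Q]_w (normv (subv (X w) (Y w)) ^+ 2)%:E <= c%:E)%E ->
  (W2 mu nu <= (Num.sqrt c)%:E)%E.
Proof.
move=> QX QY le_c.
have mXY : measurable_fun setT (fun w => (X w, Y w)).
  by apply: measurable_fun_pair; exact: measurable_funPT.
pose XY : {mfun T >-> (d.-tuple R * d.-tuple R)%type} := mfun_Sub (mem_set mXY).
pose pi : probability _ R := distribution Q XY.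
apply: (@le_trans _ _ (sqrte (\int[Q]_w (normv (subv (X w) (Y w)) ^+ 2)%:E))).
  have ge0_int : (0 <= \int[Q]_w (normv (subv (X w) (Y w)) ^+ 2)%:E)%E.
    by apply: integral_ge0 => w _; rewrite lee_fin sqr_ge0.
  rewrite /W2 lee_sqrt//; apply: ereal_inf_lbound; exists pi => /=.
    by split=> A mA; [rewrite -QX|rewrite -QY].
  rewrite ge0_integral_distribution//.
    by apply: measurable_sqr_dist.
  by move=> z; rewrite lee_fin sqr_ge0.
have c0 : 0 <= c.
  rewrite -lee_fin; apply: le_trans le_c.
  by apply: integral_ge0 => w _; rewrite lee_fin sqr_ge0.
by rewrite -[leRHS]/(sqrte c%:E) lee_sqrt.
Qed.

(** Under any coupling of a Dirac mass at [x0] with [mu], the first component is [x0] almost surely;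
    hence all couplings have the same cost. *)
Lemma W2_dirac_ge (x0 : d.-tuple R) (mu : probability (d.-tuple R) R) (w : R) :
  W2 (\d_x0) mu = w%:E ->
  (\int[mu]_x (normv (subv x0 x) ^+ 2)%:E <= (w ^+ 2)%:E)%E.
Proof.
move=> W2w; rewrite EFin_expe -W2w /W2.
set S := [set _ | _ in _].
have S0 : (0 <= ereal_inf S)%E.
  apply: le_ereal_inf_tmp => _ [pi _ <-].
  by apply: integral_ge0 => z _; rewrite lee_fin sqr_ge0.
rewrite sqr_sqrte//; apply: le_ereal_inf_tmp => _ [pi [pi1 pi2] <-].
have md : measurable_fun setT (fun x => (normv (subv x0 x) ^+ 2)%:E : \bar R).
  by apply: measurable_sqr_dist => //; exact: measurable_cst.
have -> : (\int[mu]_x (normv (subv x0 x) ^+ 2)%:E =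
    \int[pi]_z (normv (subv x0 z.2) ^+ 2)%:E)%E.
  have := @ge0_integral_pushforward _ _ _ _ R _
    (@measurable_snd _ _ (d.-tuple R) (d.-tuple R)) pi _ _ measurableT md.
  rewrite preimage_setT => <-; last by move=> x _; rewrite lee_fin sqr_ge0.
  by apply: eq_measure_integral => A mA _; have := pi2 A mA.
apply: ae_ge0_le_integral => //.
- by move=> z _; rewrite lee_fin sqr_ge0.
- apply: measurable_sqr_dist; [exact: measurable_cst|exact: measurable_snd].
- by move=> z _; rewrite lee_fin sqr_ge0.
- apply: measurable_sqr_dist; [exact: measurable_fst|exact: measurable_snd].
(* The complement of the point [x0], written through the squared distance so that [md] gives its
   measurability. *)
pose A : set (d.-tuple R) := [set x | (normv (subv x0 x) ^+ 2)%:E != 0%E].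
have mA : measurable A.
  rewrite (_ : A = ~` [set x | (normv (subv x0 x) ^+ 2)%:E = 0%E]).
    apply: measurableC; rewrite -[X in measurable X]setTI.
    by apply: (md measurableT [set 0%E]); exact: emeasurable_set1.
  by apply/seteqP; split=> x /= /eqP.
exists (fst @^-1` A); split.
- by rewrite -[X in measurable X]setTI; exact: measurable_fst.
- transitivity ((\d_x0 : set _ -> \bar R) A); first exact: pi1.
  rewrite diracE memNset//= /A/=; apply/negP.
  have -> : normv (subv x0 x0) ^+ 2 = 0.
    by rewrite sqr_normv big1// => i _; rewrite tnth_mktuple subrr expr2 mulr0.
  by rewrite eqxx.
move=> z /=; apply: contra_notN => /eqP[].
rewrite sqr_normv => /eqP; rewrite psumr_eq0; last by move=> i _; exact: sqr_ge0.
move=> /allP z0 _; have -> // : x0 = z.1.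
apply: eq_from_tnth => i; have := z0 i (mem_index_enum _).
by rewrite /= sqrf_eq0 tnth_mktuple subr_eq0 => /eqP.
Qed.

(** The space carrying [X] and [Y] is left free: it will be [Omega] for the noise error and [R^d]
    under the target law for the rounding error. *)
Lemma W2_holder_le d' (T : measurableType d') (Q : probability T R)
    (mu nu : P2 R d) (X Y : {RV Q >-> d.-tuple R}) (c L alpha : R)
    (G : P2 R d -> R) :
  0 <= L -> 0 <= alpha -> W2_holder L alpha G ->
  (forall A, measurable A -> Q (X @^-1` A) = mu A) ->
  (forall A, measurable A -> Q (Y @^-1` A) = nu A) ->
  (\int[Q]_w (normv (subv (X w) (Y w)) ^+ 2)%:E <= c%:E)%E ->
  `|G mu - G nu| <= L * Num.sqrt c `^ alpha.
Proof.
move=> L0 a0 GL QX QY le_c; rewrite -lee_fin; apply: (le_trans (GL _ _)).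
rewrite EFinM; apply: lee_wpmul2l; first by rewrite lee_fin.
have W2c := W2_le QX QY le_c.
rewrite -poweR_EFin; apply: gt0_ler_poweR => //; rewrite in_itv/= ?leey ?andbT.
- exact: sqrte_ge0.
- by rewrite lee_fin sqrtr_ge0.
Qed.

End coupling.

(** * Rounding to a grid and sampling the rounded law *)

(** Cubes of side [h] are indexed by integer vectors, the floors of [x / h]. [c] numbers them by
    [pickle]; [e] returns the lowest corner, off by at most [h] in each coordinate. *)
Lemma discretization (R : realType) (d : nat) (h : R) : 0 < h ->
  exists (c : d.-tuple R -> nat) (e : nat -> d.-tuple R),
    (forall n, measurable (c @^-1` [set n])) /\
    (forall x, normv (subv x (e (c x))) ^+ 2 <= d%:R * h ^+ 2).
Proof.
move=> h0.
pose z (x : d.-tuple R) : d.-tuple int := [tuple Num.floor (tnth x i / h) | i < d].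
pose e n : d.-tuple R := if unpickle n is Some z then
  [tuple h * (tnth (z : d.-tuple int) i)%:~R | i < d] else [tuple 0 | i < d].
exists (fun x => pickle (z x)), e; split => [n|x].
  have mz (y : d.-tuple int) : measurable (z @^-1` [set y]).
    rewrite (_ : _ @^-1` _ = \bigcap_(i in [set: 'I_d])
        (@tnth d R ^~ i) @^-1` `[h * (tnth y i)%:~R, h * (tnth y i + 1)%:~R[).
      apply: fin_bigcap_measurable => // i _.
      by rewrite -[X in measurable X]setTI; apply: measurable_tnth.
    apply/seteqP; split=> [x /= <- i _ /=|x /= xy].
      rewrite tnth_mktuple in_itv/= -ler_pdivlMl// -ltr_pdivrMl// mulrC.
      exact: floor_itv.
    apply: eq_from_tnth => i; rewrite tnth_mktuple; apply: floor_def.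
    have := xy i I; rewrite /= in_itv/= -ler_pdivlMl// -ltr_pdivrMl//.
    by rewrite mulrC.
  (* A number that codes no vector has an empty fibre; as [unpickle] may be defined there,
     [pickle y] is compared with [n]. *)
  case E : (unpickle n : option (d.-tuple int)) => [y|].
    have [yn|yn] := eqVneq (pickle y) n.
      rewrite (_ : _ @^-1` _ = z @^-1` [set y])//.
      by apply/seteqP; rewrite -yn; split=> [x /= /(pcan_inj pickleK)//|x /= ->].
    rewrite (_ : _ @^-1` _ = set0)//; apply/seteqP; split=> x //= zn.
    by move: E yn; rewrite -zn pickleK => -[<-]; rewrite eqxx.
  rewrite (_ : _ @^-1` _ = set0)//; apply/seteqP; split=> x //= zn.
  by move: E; rewrite -zn pickleK.
rewrite sqr_normv mulr_natl -[in X in _ <= _ *+ X](card_ord d) -sumr_const.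
apply: ler_sum => i _; rewrite /e pickleK !tnth_mktuple.
have /andP[] := floor_itv (tnth x i / h).
rewrite ler_pdivlMr// ltr_pdivrMr// intrD mulrDl mul1r mulrC => xl xu.
by rewrite ler_sqr ?nnegrE ?subr_ge0// ?(ltW h0)// lerBlDl; apply: ltW.
Qed.

(** The rounded law lives on a countable set, so a single real variable suffices to draw it: the
    first coordinate of the increment of [W] from 0 to [s], a Gaussian known at time [s]. *)
Lemma rounded_sample dO (Omega : measurableType dO) (R : realType)
    (P : probability Omega R) d (W : wiener P d)
    (mu : probability (d.-tuple R) R) (s h : R) : 0 < s -> 0 < h ->
  exists (Y : Omega -> d.-tuple R) (r : d.-tuple R -> d.-tuple R),
    [/\ measurable_fun [set: filtered_space W s] Y,
        measurable_fun setT r,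
        forall x, normv (subv x (r x)) ^+ 2 <= d%:R * h ^+ 2 &
        forall A, measurable A -> P (Y @^-1` A) = mu (r @^-1` A)].
Proof.
(* In dimension 0 there is no coordinate to draw from, but [R^0] is a single point. *)
move=> s0 h0; case: d => [|d] in W mu *.
  have all_eq (x y : 0.-tuple R) : x = y by apply: eq_from_tnth; case.
  exists (fun=> [tuple]), id; split => // [x|A mA].
    by rewrite mul0r sqr_normv big_ord0.
  rewrite preimage_id; have [A0|A0] := pselect (A [tuple]).
    rewrite (_ : _ @^-1` _ = setT); last by apply/seteqP; split.
    rewrite (_ : A = setT) ?probability_setT//.
    by apply/seteqP; split => // x _; rewrite (all_eq x [tuple]).
  rewrite (_ : _ @^-1` _ = set0); last by apply/seteqP; split.
  rewrite (_ : A = set0) ?measure0//.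
  by apply/seteqP; split => // x; rewrite (all_eq x [tuple]).
pose X w := tnth (W s w) ord0 - tnth (W 0 w) ord0.
have mX : measurable_fun setT X by apply: measurable_funB; exact: measurable_wiener_coord.
pose X' : {RV P >-> R} := mfun_Sub (mem_set mX).
have XN B : measurable B -> P (X' @^-1` B) = normal_prob 0 (Num.sqrt s) B.
  by move=> mB; have := wiener_coord_normal W ord0 (lexx 0) s0 mB; rewrite subr0.
have s0' : 0 < Num.sqrt s by rewrite sqrtr_gt0.
have [c [e [mc ce]]] := @discretization R d.+1 h h0.
have [N [mN PN]] := simulation (normal_cdf_continuous s0' XN) mu mc.
exists (e \o N \o X), (e \o c); split => //.
- have mXs : measurable_fun [set: filtered_space W s] X.
    by apply: measurable_funB;
      apply: (measurableT_comp (f := @tnth d.+1 R ^~ ord0));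
      (try exact: measurable_tnth);
      apply: measurable_process; rewrite ?lexx ?ltW.
  (* [e] is an arbitrary map, but every set of naturals has a measurable preimage under [N]. *)
  by move=> _ A mA; exact: (mXs measurableT _ (mN (e @^-1` A))).
- by move=> _ A mA; rewrite setTI; apply: (measurable_preimage_nat mc (e @^-1` A)).
- by move=> A mA; exact: (PN (e @^-1` A)).
Qed.

(** * The dyadic bridge towards the rounded target *)

(** The factor 2 counts two Hölder estimates, for the last uncorrected noise and for the rounding.
    In the energy, the first block accounts for [16 w^2 + 40 d] and each of the [m] others for
    [12 d]. *)
Lemma dyadic_bridge dO (Omega : measurableType dO) (R : realType)
    (P : probability Omega R) d (W : wiener P d) (mu : P2 R d)
    (x0 : d.-tuple R) (w : R) (m : nat) :
  (\int[mu]_x (normv (subv x0 x) ^+ 2)%:E <= (w ^+ 2)%:E)%E ->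
  exists theta : control W,
    (forall L alpha G, 0 <= L -> 0 <= alpha -> W2_holder L alpha G ->
      G (terminal_law x0 theta) - G mu <=
      2 * (L * Num.sqrt (d%:R * (6 * 2^-1 ^+ m.+1)) `^ alpha)) /\
    (forall a, 0 <= a ->
      (\int[P]_w (a%:E * \int[lebesgue_measure]_(s in `[0%R, 1%R])
         (normv (theta s w) ^+ 2)%:E) <=
      (a * (16 * w ^+ 2 + 40 * d%:R + 12 * d%:R * m%:R))%:E)%E).
Proof.
(* [q k] is the time left after [t k]. It halves at each step, so the block from [t k] to [t k.+1]
   has length [q k.+1]; the shift in the exponent makes [t 0] equal to 1/2. *)
move=> mu_w; pose q k : R := 2^-1 ^+ k.+1.
have qE k : q k = 2^-1 ^+ k.+1 by [].
have q_gt0 k : 0 < q k by rewrite qE exprn_gt0.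
have qS k : q k = 2 * q k.+1 by rewrite !qE [in RHS]exprS mulrA divff// mul1r.
have q0 : q 0%N = 2^-1 by rewrite qE expr1.
have q_le k : q k <= 2^-1.
  by rewrite qE exprS ger_pMr// exprn_ile1// invf_le1// ler1n.
pose t k := 1 - q k.
have t_gt0 k : 0 < t k by have := q_le k; rewrite /t; lra.
have t_lt1 k : t k < 1 by have := q_gt0 k; rewrite /t; lra.
have t_incr k : t k < t k.+1 by have := qS k; have := q_gt0 k.+1; rewrite /t; lra.
have dt k : t k.+1 - t k = q k.+1 by rewrite /t (qS k); ring.
have t_nd : {homo t : i j / (i <= j)%N >-> i <= j}.
  by apply: homo_leq => // [x y z|k]; [exact: le_trans|exact: ltW].
have [Y [r [mYs mr rE YE]]] := rounded_sample W mu (t_gt0 0%N) (q_gt0 m).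
have natY A : measurable A -> natural_filtration W (t 0%N) (Y @^-1` A).
  exact: measurable_natural_filtration.
have mY : measurable_fun setT Y.
  by move=> _ A mA; rewrite setTI; apply: natural_filtration_measurable (natY A mA).
(* From [t k] to [t k.+1], which is [q k.+1] later, the drift brings the state
   from [Y + (W (t k) - W (t k.-1))] to [Y], up to the noise of the block
   itself; at [t 0] the state is [x0 + W (t 0)]. *)
pose D k w := if k is k'.+1 then subv (W (t k') w) (W (t k) w)
  else subv (subv (Y w) x0) (W (t 0%N) w).
pose xi k w := scalev (q k.+1)^-1 (D k w).
have xi_adapted k A : measurable A -> natural_filtration W (t k) (xi k @^-1` A).
  apply: measurable_natural_filtration.
  have mW j : (j <= k)%N -> measurable_fun [set: filtered_space W (t k)] (W (t j)).
    by move=> jk; apply: measurable_process; rewrite (ltW (t_gt0 j)) t_nd.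
  have mD : measurable_fun [set: filtered_space W (t k)] (D k).
    case: k mW {xi} => [|k] mW; last by apply: measurable_subv; exact: mW.
    apply: measurable_subv; last exact: mW.
    by apply: measurable_subv => //; exact: measurable_cst.
  apply/measurable_fun_tnthP => i.
  rewrite (_ : _ \o _ = fun w => (q k.+1)^-1 * tnth (D k w) i); last first.
    by apply/funext => w'; rewrite /= tnth_mktuple.
  apply: measurable_funM; first exact: measurable_cst.
  by apply: (measurableT_comp (f := @tnth d R ^~ i)) => //; exact: measurable_tnth.
have mWt u : measurable_fun setT (W u) by exact: measurable_funPT.
have mD k : measurable_fun setT (D k).
  case: k => [|k]; last exact: measurable_subv.
  by apply: measurable_subv => //; apply: measurable_subv => //; exact: measurable_cst.
(* The bound is [2 (2 w^2 + 2 d) + 2 (6 d / 2)]: the distance from [x0] to the target, with rounding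
   error at most [d], then the noise up to time 1/2. *)
have int_D0 : (\int[P]_w' (normv (D 0%N w') ^+ 2)%:E <=
    (4 * w ^+ 2 + 10 * d%:R)%:E)%E.
  have mYx : measurable_fun setT
      (fun y : d.-tuple R => (normv (subv y x0) ^+ 2)%:E : \bar R).
    by apply: measurable_sqr_dist => //; exact: measurable_cst.
  have -> : (4 * w ^+ 2 + 10 * d%:R)%:E =
      (2%:E * (2 * w ^+ 2 + 2 * d%:R)%:E + 2%:E * (d%:R * (6 * t 0%N))%:E)%E.
    by rewrite -!EFinM -EFinD /t q0; congr EFin; field.
  have int_Y : (\int[P]_w' (normv (subv (Y w') x0) ^+ 2)%:E <=
      (2 * w ^+ 2 + 2 * d%:R)%:E)%E.
    have -> : (\int[P]_w' (normv (subv (Y w') x0) ^+ 2)%:E =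
        \int[mu]_x (normv (subv (r x) x0) ^+ 2)%:E)%E.
      have := @ge0_integral_pushforward _ _ _ _ R _ mY P _ _ measurableT mYx.
      rewrite preimage_setT => /(_ _)/esym -> //; last first.
        by move=> x _; rewrite lee_fin sqr_ge0.
      have := @ge0_integral_pushforward _ _ _ _ R _ mr mu _ _ measurableT mYx.
      rewrite preimage_setT => /(_ _)/esym -> //; last first.
        by move=> x _; rewrite lee_fin sqr_ge0.
      by apply: eq_measure_integral => A mA _; exact: YE.
    apply: (@le_trans _ _ (\int[mu]_x (2%:E * (normv (subv x0 x) ^+ 2)%:E +
        (2 * d%:R)%:E)))%E.
      apply: ge0_le_integral => //.
      - by move=> x _; rewrite lee_fin sqr_ge0.
      - exact: measurableT_comp mYx mr.
      - apply: emeasurable_funD => //; apply: emeasurable_funM => //.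
        by apply: measurable_sqr_dist => //; exact: measurable_cst.
      move=> x _; rewrite -EFinM -EFinD lee_fin.
      apply: (le_trans (sqr_dist_triangle _ x _)).
      rewrite lerD2l ler_wpM2l// (le_trans (rE x))// ler_piMr//.
      by rewrite exprn_ile1 ?(ltW (q_gt0 m))// (le_trans (q_le m))// invf_le1// ler1n.
    rewrite ge0_integralD//; last 2 first.
    - by move=> x _; rewrite -EFinM lee_fin mulr_ge0 ?sqr_ge0.
    - apply: emeasurable_funM => //.
      by apply: measurable_sqr_dist => //; exact: measurable_cst.
    rewrite integral_cst// [X in (_ + _ * X)%E](_ : _ = 1%E); last exact: probability_setT.
    rewrite mule1 [leRHS]EFinD; apply: leeD => //; rewrite ge0_integralZl//.
    - by rewrite EFinM lee_wpmul2l.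
    - by apply: measurable_sqr_dist => //; exact: measurable_cst.
    - by move=> x _; rewrite lee_fin sqr_ge0.
  apply: (@le_trans _ _ (\int[P]_w' (2%:E * (normv (subv (Y w') x0) ^+ 2)%:E +
      2%:E * (normv (W (t 0%N) w') ^+ 2)%:E))%E).
    apply: ge0_le_integral => //.
    - by move=> w' _; rewrite lee_fin sqr_ge0.
    - exact: measurable_fun_sqr_normv.
    - by apply: emeasurable_funD; apply: emeasurable_funM;
        [exact: measurable_cst|exact: measurableT_comp mYx mY|
         exact: measurable_cst|exact: measurable_fun_sqr_normv].
    - by move=> w' _; rewrite -!EFinM -EFinD lee_fin sqr_normv_subv_le.
  rewrite ge0_integralD//; last 4 first.
  - by move=> w' _; rewrite -EFinM lee_fin mulr_ge0 ?sqr_ge0.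
  - by apply: emeasurable_funM; [exact: measurable_cst|exact: measurableT_comp mYx mY].
  - by move=> w' _; rewrite -EFinM lee_fin mulr_ge0 ?sqr_ge0.
  - by apply: emeasurable_funM; [exact: measurable_cst|exact: measurable_fun_sqr_normv].
  apply: leeD; rewrite ge0_integralZl//.
  - by apply: lee_wpmul2l.
  - exact: measurableT_comp mYx mY.
  - by move=> w' _; rewrite lee_fin sqr_ge0.
  - by apply: lee_wpmul2l => //; apply: wiener_sqr_le.
  - exact: measurable_fun_sqr_normv.
  - by move=> w' _; rewrite lee_fin sqr_ge0.
have int_DS k : (\int[P]_w' (normv (D k.+1 w') ^+ 2)%:E <=
    (d%:R * (6 * q k.+1))%:E)%E.
  have := wiener_increment_sqr_le W (ltW (t_gt0 k)) (t_incr k).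
  by rewrite dt; apply: le_trans; under eq_integral do rewrite /= sqr_normv_subvC.
have int_xi k : (\int[P]_w' (normv (xi k w') ^+ 2)%:E =
    (((q k.+1)^-1) ^+ 2)%:E * \int[P]_w' (normv (D k w') ^+ 2)%:E)%E.
  under eq_integral do rewrite sqr_normv_scalev EFinM.
  rewrite ge0_integralZl// ?lee_fin ?sqr_ge0//; first exact: measurable_fun_sqr_normv.
  by move=> w' _; rewrite lee_fin sqr_ge0.
have xi_sqr k : (\int[P]_w' (normv (xi k w') ^+ 2)%:E < +oo)%E.
  rewrite int_xi lte_mul_pinfty ?lee_fin ?sqr_ge0//.
  by case: k => [|k]; [apply: le_lt_trans int_D0 _|apply: le_lt_trans (int_DS k) _];
    rewrite ltry.
have t0 := ltW (t_gt0 0%N); have t1 k := ltW (t_lt1 k).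
pose theta := step_control m.+1 t0 t_nd t1 xi_adapted xi_sqr.
have drift w' i : (\int[lebesgue_measure]_(s in `[0%R, 1%R]) tnth (theta s w') i)%R =
    tnth (Y w') i - tnth x0 i - tnth (W (t m) w') i.
  rewrite step_control_drift.
  under eq_bigr do rewrite dt tnth_mktuple mulrA divff ?gt_eqF// mul1r.
  (* The displacements telescope, cancelling all the noise up to [t n]. Only the noise after [t m]
     will separate the terminal state from [Y]. *)
  have sumD n : \sum_(k < n.+1) tnth (D k w') i =
      tnth (Y w') i - tnth x0 i - tnth (W (t n) w') i.
    elim: n => [|n IHn]; first by rewrite big_ord1 /= !tnth_mktuple.
    by rewrite big_ord_recr/= IHn tnth_mktuple; ring.
  exact: sumD.
have state1 w' : subv (state x0 theta 1 w') (Y w') = subv (W 1 w') (W (t m) w').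
  by apply: eq_from_tnth => i; rewrite !tnth_mktuple drift; ring.
exists theta; split => [L alpha G L0 alpha0 GL|a a0]; last first.
  rewrite step_control_energy// EFinM lee_wpmul2l ?lee_fin//.
  have term k : ((t k.+1 - t k)%:E * \int[P]_w' (normv (xi k w') ^+ 2)%:E =
      ((q k.+1)^-1)%:E * \int[P]_w' (normv (D k w') ^+ 2)%:E)%E.
    rewrite int_xi muleA -EFinM dt expr2 mulrA divff ?mul1r// gt_eqF//.
  rewrite big_ord_recl.
  have -> : (16 * w ^+ 2 + 40 * d%:R + 12 * d%:R * m%:R)%:E =
      (((q 1%N)^-1)%:E * (4 * w ^+ 2 + 10 * d%:R)%:E +
       \sum_(k < m) (12 * d%:R)%:E)%E.
    rewrite sumEFin sumr_const card_ord -EFinM -EFinD; congr EFin.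
    by rewrite qE expr2 -[in RHS]mulr_natr; field.
  apply: leeD.
    rewrite term; apply: lee_wpmul2l; last exact: int_D0.
    by rewrite lee_fin invr_ge0 ltW.
  apply: lee_sum => k _; rewrite term lift0.
  (* A block of length [q k.+2] corrects the noise of the preceding one, twice as long: the quotient
     [6 d q k.+1 / q k.+2] is [12 d], whatever [k]. *)
  apply: (@le_trans _ _ ((q k.+2)^-1%:E * (d%:R * (6 * q k.+1))%:E)%E).
    by apply: lee_wpmul2l; [rewrite lee_fin invr_ge0 ltW|exact: int_DS].
  rewrite -EFinM lee_fin (qS k.+1) le_eqVlt; apply/orP; left; apply/eqP.
  by field; rewrite gt_eqF.
pose r' : {RV (mu : probability _ R) >-> d.-tuple R} := mfun_Sub (mem_set mr).
pose id' : {RV (mu : probability _ R) >-> d.-tuple R} :=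
  mfun_Sub (mem_set (@measurable_id _ _ setT)).
pose Y' : {RV P >-> d.-tuple R} := mfun_Sub (mem_set mY).
(* [G] is defined on [P2] only, so the rounded law must be shown to belong to it. *)
have nu2 : (second_moment (distribution mu r') < +oo)%E.
  rewrite /second_moment ge0_integral_distribution//; last 2 first.
  - by apply/measurable_EFinP; exact: measurable_sqr_normv.
  - by move=> x; rewrite lee_fin sqr_ge0.
  apply: (@le_lt_trans _ _ (\int[mu]_x (2%:E * (normv x ^+ 2)%:E +
      (2 * (d%:R * q m ^+ 2))%:E)))%E.
    apply: ge0_le_integral => //.
    - by move=> x _; rewrite lee_fin sqr_ge0.
    - exact: measurable_fun_sqr_normv.
    - apply: emeasurable_funD => //; apply: emeasurable_funM => //.
      by apply/measurable_EFinP; exact: measurable_sqr_normv.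
    move=> x _; rewrite -EFinM -EFinD lee_fin /=.
    have -> : r x = subv x (subv x (r x)).
      by apply: eq_from_tnth => i; rewrite !tnth_mktuple; ring.
    apply: (le_trans (sqr_normv_subv_le _ _)).
    by rewrite lerD2l ler_wpM2l// rE.
  have mN : measurable_fun setT (fun x : d.-tuple R => (normv x ^+ 2)%:E : \bar R).
    by apply/measurable_EFinP; exact: measurable_sqr_normv.
  rewrite ge0_integralD//; last 3 first.
  - by move=> x _; rewrite -EFinM lee_fin mulr_ge0 ?sqr_ge0.
  - exact: emeasurable_funM.
  - by move=> x _; rewrite lee_fin mulr_ge0// mulr_ge0// sqr_ge0.
  rewrite integral_cst// [X in (_ + _ * X)%E](_ : _ = 1%E); last exact: probability_setT.
  rewrite mule1 lte_add_pinfty ?ltry// ge0_integralZl//.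
    by rewrite lte_mul_pinfty//; exact: (P2_second_moment mu).
  by move=> x _; rewrite lee_fin sqr_ge0.
pose nu : P2 R d := MkP2 nu2.
have muE A : measurable A -> (mu : probability _ R) (id' @^-1` A) = mu A by [].
have nuE A : measurable A -> (mu : probability _ R) (r' @^-1` A) = nu A by [].
have lawE A : measurable A ->
  P (terminal_state x0 theta @^-1` A) = terminal_law x0 theta A by [].
have YnuE A : measurable A -> P (Y' @^-1` A) = nu A by move=> mA; exact: YE.
(* The rounded law [nu] is the intermediary: it is the law of [Y] on [Omega], next to the terminal
   state, and the law of [r] under [mu], next to the identity. *)
rewrite (_ : G _ - G mu = (G (terminal_law x0 theta) - G nu) + (G nu - G mu));
  last by ring.
rewrite mulr_natl mulr2n; apply: lerD; apply: (le_trans (ler_norm _)).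
  apply: (W2_holder_le L0 alpha0 GL lawE YnuE).
  rewrite -/(q m) (_ : q m = 1 - t m); last by rewrite /t; ring.
  apply: le_trans (wiener_increment_sqr_le W (ltW (t_gt0 m)) (t_lt1 m)).
  by under eq_integral do rewrite /= state1.
apply: (W2_holder_le L0 alpha0 GL nuE muE).
apply: (@le_trans _ _ (\int[mu]_x (d%:R * q m ^+ 2)%:E)%E).
  apply: ge0_le_integral => //.
  - by move=> x _; rewrite lee_fin sqr_ge0.
  - by apply: measurable_sqr_dist.
  - by move=> x _; rewrite lee_fin /= sqr_normv_subvC.
rewrite integral_cst// [X in (_ * X)%E](_ : _ = 1%E); last exact: probability_setT.
(* As [q m <= 1/2], the rounding error [d (q m)^2] is below the bound [6 d q m] for the noise. *)
rewrite mule1 lee_fin ler_wpM2l// -/(q m) expr2.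
have := q_le m; have := q_gt0 m; nra.
Qed.

(** * Choice of the dyadic scale and conclusion *)

Lemma ln_inv_ge1 (R : realType) (eps : R) :
  0 < eps -> eps < expR (- 1) -> 1 <= ln (1 / eps).
Proof.
move=> e0 /ltW e1.
by rewrite div1r lnV ?posrE// lerNr -[leRHS]expRK ler_ln ?posrE ?expR_gt0.
Qed.

(** Take the integer part of [4 l / alpha], with [l = ln (1 / eps)]. Since [1/2 <= exp (- 1/2)],
    [2^-(m + 1)] is at most [exp (- 2 l / alpha)], whose power [alpha / 2] is [exp (- l) = eps]. *)
Lemma exists_dyadic_scale (R : realType) (alpha eps : R) :
  0 < alpha -> 0 < eps -> eps < expR (- 1) ->
  exists m : nat, m%:R <= 4 / alpha * ln (1 / eps) /\
    Num.sqrt (2^-1 ^+ m.+1) `^ alpha <= eps.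
Proof.
move=> a0 e0 e1; set l := ln (1 / eps).
have l1 : 1 <= l := ln_inv_ge1 e0 e1.
have l0 : 0 <= l by lra.
have epsE : eps = expR (- l) by rewrite /l div1r lnV ?posrE// opprK lnK.
exists (Num.truncn (4 / alpha * l)).
have [|ml lm] := andP (@truncn_itv R (4 / alpha * l) _).
  by rewrite mulr_ge0// divr_ge0// ltW.
split=> //; set m := Num.truncn _ in lm *.
have half : 2^-1 <= expR (- 2^-1) :> R.
  by have := expR_ge1Dx (- 2^-1 : R); lra.
rewrite -powR12_sqrt ?exprn_ge0// -powRrM.
apply: (@le_trans _ _ (expR (- (2 / alpha * l)) `^ (2^-1 * alpha))).
  apply: ge0_ler_powR; rewrite ?nnegrE ?exprn_ge0 ?expR_ge0//.
    by rewrite mulr_ge0// ltW.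
  apply: (@le_trans _ _ (expR (- 2^-1) ^+ m.+1)).
    by apply: lerXn2r; rewrite ?nnegrE ?expR_ge0 ?invr_ge0.
  rewrite -expRM_natl ler_expR.
  have E4 : 4 / alpha * l = 2 * (2 / alpha * l) by ring.
  rewrite E4 in lm.
  lra.
rewrite -expRM epsE ler_expR le_eqVlt; apply/orP; left; apply/eqP.
by field; rewrite gt_eqF.
Qed.

Unset Implicit Arguments.

Theorem theorem3p5 (R : realType) (d : nat) (L alpha w : R) :
  0 < L -> 0 < alpha -> alpha <= 1 ->
  exists C : R, 0 < C /\
    forall (dO : measure_display) (Omega : measurableType dO)
      (P : probability Omega R) (W : wiener P d) (G : P2 R d -> R)
      (mu_star : P2 R d) (x0 : d.-tuple R),
    measure_is_complete P ->
    W2_holder L alpha G ->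
    (forall mu : P2 R d, G mu_star <= G mu) ->
    W2 (\d_x0) mu_star = w%:E ->
    let V0 := ereal_inf [set (G mu)%:E | mu in [set: P2 R d]] in
    forall eps : R, 0 < eps -> eps < expR (- 1) ->
      (0 <= value W x0 G eps - V0)%E /\
      (value W x0 G eps - V0 <= (C * (eps * ln (1 / eps)))%:E)%E.
Proof.
move=> L0 a0 a1.
pose K := Num.sqrt (d%:R * 6 : R) `^ alpha.
(* [2 L K] bounds the loss in [G]. The next two terms are half of the energy [16 w^2 + 40 d]; then
   [6 d m] with [m <= 4 l / alpha] gives [24 d / alpha]. The final 1 keeps [C] positive when all the
   rest vanishes, as for [d = 0] and [w = 0]. *)
pose C := 2 * L * K + 8 * w ^+ 2 + 20 * d%:R + 24 * d%:R / alpha + 1.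
have K0 : 0 <= K by exact: powR_ge0.
have C1 : 0 <= 2 * L * K by rewrite !mulr_ge0// ltW.
have C2 : 0 <= 24 * d%:R / alpha by rewrite divr_ge0 ?mulr_ge0// ltW.
have w2 := sqr_ge0 w; have d0 : 0 <= d%:R :> R by [].
exists C; split=> [|dO Omega P W G mu x0 _ GL Gmin W2w V0 eps e0 e1].
  by rewrite /C; lra.
have V0E : V0 = (G mu)%:E.
  apply/eqP; rewrite eq_le; apply/andP; split.
    by apply: ereal_inf_lbound; exists mu.
  by apply: le_ereal_inf_tmp => _ [nu _ <-]; rewrite lee_fin.
have valueV : ((G mu)%:E <= value W x0 G eps)%E.
  apply: le_ereal_inf_tmp => _ [theta _ <-]; rewrite /cost.
  rewrite -[leLHS]adde0; apply: leeD; first by rewrite lee_fin.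
  apply: integral_ge0 => om _; apply: mule_ge0; first by rewrite lee_fin divr_ge0// ltW.
  by apply: integral_ge0 => s _; rewrite lee_fin sqr_ge0.
rewrite V0E sube_ge0 ?fin_numE//; split => //.
have [m [mle qle]] := exists_dyadic_scale a0 e0 e1.
pose q : R := 2^-1 ^+ m.+1.
have [theta [Gle energy]] := dyadic_bridge W m (W2_dirac_ge W2w).
rewrite leeBlDr//; apply: (@le_trans _ _ (cost x0 G eps theta)).
  by apply: ereal_inf_lbound; exists theta.
have e2 : 0 <= eps / 2 by rewrite divr_ge0// ltW.
rewrite /cost; apply: (le_trans (leeD2l _ (energy _ e2))).
rewrite -!EFinD lee_fin.
have := Gle _ _ _ (ltW L0) (ltW a0) GL.
have -> : Num.sqrt (d%:R * (6 * q)) `^ alpha = K * Num.sqrt q `^ alpha.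
  by rewrite mulrA sqrtrM ?mulr_ge0// powRM ?sqrtr_ge0.
have := ler_wpM2l (mulr_ge0 (ltW L0) K0) qle; rewrite -/q.
set l := ln (1 / eps) in mle *.
have l1 : 1 <= l := ln_inv_ge1 e0 e1.
set X := _ `^ alpha => LKX GX.
(* Here [eps < exp (- 1)] enters: as [l >= 1], the terms of order [eps] are absorbed. *)
have el : eps <= eps * l by rewrite ler_peMr// ltW.
have b1 := ler_wpM2l C1 el.
have b2 : (8 * w ^+ 2 + 20 * d%:R) * eps <= (8 * w ^+ 2 + 20 * d%:R) * (eps * l).
  by apply: ler_wpM2l el; lra.
have b3 : 6 * d%:R * eps * m%:R <= 24 * d%:R / alpha * (eps * l).
  have -> : 24 * d%:R / alpha * (eps * l) = 6 * d%:R * eps * (4 / alpha * l) by ring.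
  by apply: ler_wpM2l mle; rewrite !mulr_ge0// ltW.
rewrite /C; lra.
Qed.
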